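(* Let $(R,\mathfrak m)$ be a commutative Noetherian local ring satisfying $\mathfrak m^4=0$ and $\mathfrak m^3\neq 0$. Let $M$ and $N$ be finitely generated $R$-modules, each with an eventually linear minimal free resolution over $R$, and suppose that $\operatorname{Ext}_R^i(N,R)=0$ for all $i\gg 0$. If the Betti sequence of $M$ has polynomial growth, whereas the Betti sequence of $N$ has exponential growth, then the Hilbert polynomial of $R$ is $$H_R(t)=1+et+et^2+t^3,$$ where $e=\dim_{R/\mathfrak m}\mathfrak m/\mathfrak m^2$.
   Context: Write $k=R/\mathfrak m$. The Hilbert polynomial of $R$ is $H_R(t)=\sum_{i\ge 0}\dim_k(\mathfrak m^i/\mathfrak m^{i+1})\,t^i$. The Betti numbers of a finitely generated $R$-module $M$ are $b_n(M)=\dim_k\operatorname{Tor}_n^R(M,k)$, and its Betti sequence is $\{b_i(M)\}_{i\ge 0}$; write $b_i$ for its terms. Eventually linear: Let $\mathbf F=(F_i,\partial_i)$ be the minimal free resolution of $M$. The associated graded complex is $\operatorname{gr}_{\mathfrak m}(\mathbf F)=\bigoplus_{j\in\mathbb Z}\operatorname{gr}_{\mathfrak m}(\mathbf F)^j$, where $\operatorname{gr}_{\mathfrak m}(\mathbf F)^j$ is the complex whose $i$-th term is $\mathfrak m^{j-i}F_i/\mathfrak m^{j-i+1}F_i$ and whose differentials $\mathfrak m^{j-i}F_i/\mathfrak m^{j-i+1}F_i\to \mathfrak m^{j-i+1}F_{i-1}/\mathfrak m^{j-i+2}F_{i-1}$ are induced by $\partial_i$ (convention: $\mathfrak m^n=R$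 for $n\le 0$). The linearity defect of $M$ is $\operatorname{ld}_R(M)=\inf\{n\in\mathbb N\mid \operatorname H_i(\operatorname{gr}_{\mathfrak m}(\mathbf F))=0\text{ for all } i\ge n\}$. The resolution $\mathbf F$ is eventually linear if $\operatorname{ld}_R(M)$ is finite and positive. Polynomial growth: there exist $n\in\mathbb N$ (with $0\in\mathbb N$), a real $\alpha>0$ and a sequence of real numbers $\{\lambda_i\}$ with $\lambda_i/i^n\to 0$ such that $\alpha i^n-\lambda_i\le b_i\le \alpha i^n+\lambda_i$ for all $i\gg 0$. Exponential growth: for some real $a>1$ (the base) there exist a real $\beta>0$ and a sequence of real numbers $\{\rho_i\}$ with $\rho_i/a^i\to 0$ such that $\beta a^i-\rho_i\le b_i\le\beta a^i+\rho_i$ for all $i\gg 0$. *)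

(* Defs.v *)
From HB Require Import structures.
From mathcomp Require Import all_boot all_order all_algebra.
From mathcomp Require Import all_classical all_reals all_analysis.

Set Implicit Arguments.
Unset Strict Implicit.
Unset Printing Implicit Defensive.

Import Order.TTheory GRing.Theory Num.Theory.
Import numFieldNormedType.Exports.

Local Open Scope classical_set_scope.
Local Open Scope ring_scope.

Section Ideals.
Variable R : comNzRingType.

Definition is_ideal (I : set R) : Prop :=
  I 0 /\ forall a x y, I x -> I y -> I (a * x + y).

Definition noetherian : Prop :=
  forall I : set R, is_ideal I -> exists (n : nat) (g : 'I_n -> R),
    I = [set x | exists c : 'I_n -> R, x = \sum_i c i * g i].

Definition maximal_ideal (I : set R) : Prop :=
  [/\ is_ideal I, I <> setT &
      forall J : set R, is_ideal J -> I `<=` J -> J = I \/ J = setT].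

Definition local_ring (m : set R) : Prop :=
  maximal_ideal m /\ forall I, maximal_ideal I -> I = m.

Definition finitely_generated (M : lmodType R) : Prop :=
  exists (n : nat) (g : 'I_n -> M),
    forall x, exists c : 'I_n -> R, x = \sum_i c i *: g i.

Definition ideal_smul (V : lmodType R) (I : set R) (A : set V) : set V :=
  [set v | exists (n : nat) (a : 'I_n -> R) (x : 'I_n -> V),
     (forall i, I (a i) /\ A (x i)) /\ v = \sum_i a i *: x i].

Definition ideal_pow (m : set R) (n : nat) : set R :=
  iter n (fun J : set R => @ideal_smul R^o m J) setT.

Definition ideal_powz (m : set R) (z : int) : set R :=
  if z is Posz n then ideal_pow m n else setT.

(* dim_{R/m} (A / B) = n, for submodules B of A with mA contained in B: the
   classes of the [v i] form a basis of A / B over R / m.  Scalars and vectors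
   are represented by lifts to R and A. *)
Definition has_kdim (m : set R) (V : lmodType R) (A B : set V) (n : nat) :
    Prop :=
  exists v : 'I_n -> V,
    [/\ forall i, A (v i),
        forall x, A x -> exists c : 'I_n -> R, B (x - \sum_i c i *: v i) &
        forall c : 'I_n -> R, B (\sum_i c i *: v i) -> forall i, m (c i)].

Definition is_hilbert_poly (m : set R) (H : {poly nat}) : Prop :=
  forall i, @has_kdim m R^o (ideal_pow m i) (ideal_pow m i.+1) (H`_i)%R.

End Ideals.

Section Resolutions.
Variable R : comNzRingType.

(* Resolutions by finitely generated free modules F_i = R^(rk i), whose elements
   are row vectors; [dmx i] is the matrix of the differential with index i + 1,
   from F_(i+1) to F_i.  Finitely generated modules over Noetherian rings have
   such resolutions. *)
Record free_resolution (M : lmodType R) := FreeResolution {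
  rk : nat -> nat;
  dmx : forall i, 'M[R]_(rk i.+1, rk i);
  aug : {linear 'rV[R]_(rk 0) -> M};
  aug_surj : forall x, exists v, aug v = x;
  exact_aug : forall v, aug v = 0 <-> exists w, v = w *m dmx 0;
  exact_diff : forall i (v : 'rV[R]_(rk i.+1)),
    v *m dmx i = 0 <-> exists w, v = w *m dmx i.+1
}.

Section Homology.
Variables (M : lmodType R) (F : free_resolution M).

Definition minimal (m : set R) : Prop :=
  forall i (x : 'rV[R]_(rk F i.+1)), ideal_smul m setT (x *m dmx F i).

(* For families of submodules B_i of A_i of F_i that are compatible with the
   differential, [cycles A B i] and [boundaries A B i] are the preimages in A_i
   of the cycles and the boundaries in degree i of the complex A / B.  The
   differential of degree 0 is zero. *)
Definition cycles (A B : forall i, set 'rV[R]_(rk F i)) (i : nat) :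
    set 'rV[R]_(rk F i) :=
  match i with
  | 0 => A 0%N
  | i'.+1 => [set x | A i'.+1 x /\ B i' (x *m dmx F i')]
  end.

Definition boundaries (A B : forall i, set 'rV[R]_(rk F i)) (i : nat) :
    set 'rV[R]_(rk F i) :=
  [set x | exists y z, [/\ A i.+1 y, B i z & x = y *m dmx F i + z]].

(* gr(F)^j in homological degree i is [grF m j i] / [grF m (j + 1) i]. *)
Definition grF (m : set R) (j : int) (i : nat) : set 'rV[R]_(rk F i) :=
  ideal_smul (ideal_powz m (j - i%:Z)) setT.

Arguments cycles : clear implicits.
Arguments boundaries : clear implicits.
Arguments grF : clear implicits.

Definition gr_homology_zero (m : set R) (i : nat) : Prop :=
  forall j : int, cycles (grF m j) (grF m (j + 1)) i
                    `<=` boundaries (grF m j) (grF m (j + 1)) i.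

Definition gr_acyclic_from (m : set R) (n : nat) : Prop :=
  forall i, (n <= i)%N -> gr_homology_zero m i.

(* The linearity defect of M is finite and equal to n (for F minimal). *)
Definition is_linearity_defect (m : set R) (n : nat) : Prop :=
  gr_acyclic_from m n /\ forall n', gr_acyclic_from m n' -> (n <= n')%N.

(* Tor_n(M, k) is the homology of F tensor k = F / mF. *)
Definition has_Tor_kdim (m : set R) (n b : nat) : Prop :=
  let A i := setT : set 'rV[R]_(rk F i) in
  let B i := ideal_smul m setT : set 'rV[R]_(rk F i) in
  has_kdim m (cycles A B n) (boundaries A B n) b.

Definition coboundary (i : nat) : set {linear 'rV[R]_(rk F i) -> R^o} :=
  match i with
  | 0 => [set phi : {linear 'rV[R]_(rk F 0) -> R^o} | forall x, phi x = 0]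
  | i'.+1 => [set phi : {linear 'rV[R]_(rk F i'.+1) -> R^o} |
                exists psi : {linear 'rV[R]_(rk F i') -> R^o},
                  forall x, phi x = psi (x *m dmx F i')]
  end.

Definition cocycle (i : nat) : set {linear 'rV[R]_(rk F i) -> R^o} :=
  [set phi : {linear 'rV[R]_(rk F i) -> R^o} |
     forall x, phi (x *m dmx F i) = 0].

End Homology.

Arguments coboundary {M} F i.
Arguments cocycle {M} F i.

(* Minimal free resolutions are unique up to isomorphism, and Tor and Ext do not
   depend on the resolution, so each of these notions asks for one resolution. *)
Definition eventually_linear (m : set R) (M : lmodType R) : Prop :=
  exists F : free_resolution M, minimal F m /\
    exists n, (0 < n)%N /\ is_linearity_defect F m n.

Definition is_betti_sequence (m : set R) (M : lmodType R) (b : nat -> nat) :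
    Prop :=
  forall n, exists F : free_resolution M, has_Tor_kdim F m n (b n).

(* Ext^i(M, R) = 0 *)
Definition Ext_zero (M : lmodType R) (i : nat) : Prop :=
  exists F : free_resolution M, cocycle F i `<=` coboundary F i.

End Resolutions.

Arguments cycles {R M F} A B i _.
Arguments boundaries {R M F} A B i _.
Arguments grF {R M} F m j i _.
Arguments coboundary {R M} F i _.
Arguments cocycle {R M} F i _.

Definition polynomial_growth (K : realType) (b : nat -> nat) : Prop :=
  exists (n : nat) (alpha : K) (lambda : nat -> K),
    [/\ 0 < alpha,
        (fun i => lambda i / i%:R ^+ n) @ \oo --> (0 : K) &
        \forall i \near \oo,
          alpha * i%:R ^+ n - lambda i <= (b i)%:R
            <= alpha * i%:R ^+ n + lambda i].

Definition exponential_growth (K : realType) (b : nat -> nat) : Prop :=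
  exists (a beta : K) (rho : nat -> K),
    [/\ 1 < a, 0 < beta,
        (fun i => rho i / a ^+ i) @ \oo --> (0 : K) &
        \forall i \near \oo,
          beta * a ^+ i - rho i <= (b i)%:R <= beta * a ^+ i + rho i].

(* Main.v *)
Require Import Defs.
From HB Require Import structures.
From mathcomp Require Import all_boot all_order all_algebra.
From mathcomp Require Import all_classical all_reals all_analysis.
From mathcomp Require Import zify ring lra.

Import Order.TTheory GRing.Theory Num.Theory.
Import numFieldNormedType.Exports.
Local Open Scope classical_set_scope.
Local Open Scope ring_scope.

Set Implicit Arguments.
Unset Strict Implicit.
Unset Printing Implicit Defensive.

(* Let H_R = 1 + e t + r t^2 + s t^3, and let a_j, b_i be the ranks in minimal
   resolutions of M and N.  Exactness of the associated graded complexes gives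
   both sequences the recurrence with characteristic polynomial
   p = T^3 - e T^2 + r T - s.  Polynomial growth gives p(1) = 0 and exponential
   growth with base x gives p(x) = 0, so r = e - 1 + s and x, s/x are the roots
   of T^2 - (e - 1) T + s.

   It remains to see s = 1.  Let S_j be the syzygies of M.  Since Ext(N, R)
   vanishes eventually, Ext^i(N, S_j) depends only on i - j, so its length stays
   bounded along i = j.  Hence the cocycles Z^i of Hom(F_N, S_j) satisfy
   len Z^i + len Z^(i+1) <= b_i len S_j + O(1).  On the other hand Z^i contains
   (m^2 S_j)^(b_i), and Z^(i+1) also contains the coboundaries, whose image
   modulo m^2 S_j is bounded below by linearity of the resolution of N, one
   generator of S_j at a time.  Dividing by a_j b_i and passing to the limit
   yields e (e - x s) >= x - 1 > 0.  For s >= 2 this forces s < e - 1 < s + 1. *)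

(** * Submodules and length *)

(** By linearity of the resolution of M and its growth ratio 1, the layers S_j/mS_j, mS_j/m^2S_j and
    m^2S_j have lengths asymptotic to 1, e - 1 and s times the number a_(j+1) of generators of S_j.
    The layer m^2S_j is easy, since m^4 = 0 makes all cochains with values in it cocycles. The
    obstacle is the middle layer. Let a generator g of S_j contribute c to the length of
    mS_j/m^2S_j, and let q be the length that coboundaries of cochains with values in Rg add to
    Z^(i+1). Linearity for N gives b_(i+1) <= q c + b_i (e - c). Replacing q c by q e makes this
    linear in q and c, so it can be summed over the generators, where the c add up to at least the
    length of the middle layer. In the limit this becomes e s (1 + x) + x + (e - 1) <= e (e + s) +
    e. The Betti numbers of M may stay bounded, so it is the exponential growth for N that makes the
    bounded Ext term negligible after division. Finally s < e - 1 < s + 1 is absurd because e and s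
    are integers. *)

Section Submodules.
Context {R : comNzRingType}.

Definition submod {V : lmodType R} (A : set V) : Prop :=
  A 0 /\ forall a x y, A x -> A y -> A (a *: x + y).

Definition addset {V : lmodType R} (A B : set V) : set V :=
  [set x | exists y z, [/\ A y, B z & x = y + z]].

Section Closure.
Context {V : lmodType R} (A : set V) (hA : submod A).

Lemma submod_0 : A 0.
Proof. by case: hA. Qed.

Lemma submod_D x y : A x -> A y -> A (x + y).
Proof. by move=> Ax Ay; rewrite -[x]scale1r; apply: hA.2. Qed.

Lemma submod_Z a x : A x -> A (a *: x).
Proof. by move=> Ax; rewrite -[_ *: _]addr0; apply: hA.2 => //; apply: hA.1. Qed.

Lemma submod_N x : A x -> A (- x).
Proof. by move=> Ax; rewrite -scaleN1r; apply: submod_Z. Qed.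

Lemma submod_B x y : A x -> A y -> A (x - y).
Proof. by move=> Ax Ay; apply: submod_D => //; apply: submod_N. Qed.

Lemma submod_sum (I : finType) (F : I -> V) :
  (forall i, A (F i)) -> A (\sum_i F i).
Proof.
move=> AF; apply: (big_ind A) => //; [exact: submod_0|exact: submod_D].
Qed.

End Closure.

Context {V W : lmodType R}.
Implicit Types A B C : set V.

Lemma submod_setT : submod (setT : set V).
Proof. by split. Qed.

Lemma submod_set0 : submod ([set 0] : set V).
Proof. by split=> // a x y /= -> ->; rewrite scaler0 addr0. Qed.

Lemma submod_setI A B : submod A -> submod B -> submod (A `&` B).
Proof.
move=> [A0 hA] [B0 hB]; split=> // a x y [Ax Bx] [Ay By].
by split; [apply: hA | apply: hB].
Qed.

Lemma submod_addset A B : submod A -> submod B -> submod (addset A B).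
Proof.
move=> hA hB; split; first by exists 0, 0; rewrite addr0; split=> //; [case: hA|case: hB].
move=> a _ _ [x1 [x2 [Ax Bx ->]]] [y1 [y2 [Ay By ->]]].
exists (a *: x1 + y1), (a *: x2 + y2); split; [exact: hA.2|exact: hB.2|].
by rewrite scalerDr addrACA.
Qed.

Lemma submod_preimage (f : {linear V -> W}) (B : set W) :
  submod B -> submod (f @^-1` B).
Proof.
move=> [B0 hB]; split; first by rewrite /preimage /= linear0.
by move=> a x y fx fy; rewrite /preimage /= linearP; apply: hB.
Qed.

Lemma submod_image (f : {linear V -> W}) A : submod A -> submod (f @` A).
Proof.
move=> [A0 hA]; split; first by exists 0 => //; rewrite linear0.
move=> a _ _ [x Ax <-] [y Ay <-]; exists (a *: x + y); first exact: hA.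
by rewrite linearP.
Qed.

Lemma addset_subl A B : submod B -> A `<=` addset A B.
Proof. by move=> hB x Ax; exists x, 0; rewrite addr0; split=> //; case: hB. Qed.

Lemma addset_subr A B : submod A -> B `<=` addset A B.
Proof. by move=> hA x Ax; exists 0, x; rewrite add0r; split=> //; case: hA. Qed.

Lemma addset_sub A B C : submod C -> A `<=` C -> B `<=` C -> addset A B `<=` C.
Proof.
by move=> hC AC BC _ [y [z [/AC Ay /BC Bz ->]]]; apply: submod_D.
Qed.

Lemma addset_mono A B A' : A `<=` A' -> addset A B `<=` addset A' B.
Proof. by move=> AA' _ [y [z [Ay Bz ->]]]; exists y, z; split=> //; apply: AA'. Qed.

End Submodules.

(** * Length of a quotient as the maximal number of strict steps *)

Section Length.
Context {R : comNzRingType}.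

(** Lengths are counted by chains between two subsets, so that no quotient module is ever formed.
    The inclusion of [B] in the lowest member is not a step. *)
Fixpoint chain {V : lmodType R} (B A : set V) (n : nat) : Prop :=
  if n is n'.+1 then exists C, [/\ submod C, chain B C n' & C `<` A]
  else B `<=` A.

Definition finite_length (V : lmodType R) : Prop :=
  exists N, forall n, chain [set 0 : V] setT n -> (n <= N)%N.

(* The value is meaningful when [V] has finite length and [B] is contained in
   [A]. *)
Definition len {V : lmodType R} (B A : set V) : nat :=
  xget 0%N [set n | chain B A n /\ forall k, chain B A k -> (k <= n)%N].

Section Chains.
Context {V : lmodType R}.
Implicit Types A B C K : set V.

Lemma chain_subl B B' A n : B' `<=` B -> chain B A n -> chain B' A n.
Proof.
move=> BB; elim: n A => [|n IH] A /=; first by move=> BA x /BB /BA.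
by move=> [C [hC /IH BC CA]]; exists C.
Qed.

Lemma chain_subr B A A' n : A `<=` A' -> chain B A n -> chain B A' n.
Proof.
case: n => [|n] AA' /=; first by move=> BA x /BA /AA'.
move=> [C [hC BC [CA nAC]]]; exists C; split=> //; split.
  by move=> x /CA /AA'.
by move=> A'C; apply: nAC => x /AA' /A'C.
Qed.

Lemma chain_sub B A n : chain B A n -> B `<=` A.
Proof.
elim: n A => [//|n IH] A /= [C [_ /IH BC [CA _]]].
by move=> x /BC /CA.
Qed.

Lemma chain_cat B K A n1 n2 :
  chain B K n1 -> chain K A n2 -> chain B A (n1 + n2).
Proof.
move=> cBK; elim: n2 A => [|n2 IH] A.
  by rewrite addn0 => KA; apply: chain_subr KA cBK.
by rewrite addnS /= => -[C [hC /IH BC CA]]; exists C.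
Qed.

(* By the modular law, a strict step of a chain stays strict after intersecting
   with [K] or after adding [K]. *)
Lemma chain_split B K A n : submod K -> submod A -> B `<=` K -> chain B A n ->
  exists n1 n2, [/\ (n <= n1 + n2)%N, chain B (A `&` K) n1
                  & chain K (addset A K) n2].
Proof.
move=> hK; elim: n A => [|n IH] A hA BK /=.
  move=> BA; exists 0%N, 0%N; split=> //=; first by move=> x Bx; split; auto.
  exact: addset_subr.
move=> [C [hC /(IH _ hC BK) [n1 [n2 [le_n c1 c2]]] [CA nAC]]].
have CAK : C `&` K `<=` A `&` K by move=> x [/CA].
have CAK' := @addset_mono _ _ C K A CA.
have [AKC|nAKC] := pselect (A `&` K `<=` C `&` K).
  exists n1, n2.+1; split; first by rewrite addnS.
    exact: chain_subr CAK c1.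
  exists (addset C K); split=> //; first exact: submod_addset.
  split=> // AC; apply: nAC => x Ax.
  have [y [z [Cy Kz xE]]] := AC _ (addset_subl hK Ax).
  suff: C z by rewrite xE => Cz; apply: submod_D.
  have -> : z = x - y by rewrite xE addrC addKr.
  apply: (AKC _ _).1; split; last by rewrite xE addrC addKr.
  by apply: submod_B => //; apply: CA.
exists n1.+1, n2; split; first by rewrite addSn.
  by exists (C `&` K); split=> //; apply: submod_setI.
exact: chain_subr CAK' c2.
Qed.

Lemma finite_chain : finite_length V -> exists N, forall B A n,
  submod B -> chain B A n -> (n <= N)%N.
Proof.
move=> [N hN]; exists N => B A n hB c; apply: hN.
apply: (@chain_subr _ A) => //; apply: chain_subl c.
by move=> x ->; apply: submod_0.
Qed.

Hypothesis fV : finite_length V.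

Lemma lenP B A : submod B -> B `<=` A ->
  chain B A (len B A) /\ forall k, chain B A k -> (k <= len B A)%N.
Proof.
move=> hB BA; rewrite /len; case: xgetP => [//|noS].
have [N hN] := finite_chain fV.
pose P n := `[< chain B A n >].
have exP : exists n, P n by exists 0%N; apply/asboolP.
have ubP n : P n -> (n <= N)%N by move=> /asboolP; apply: hN.
have [n /asboolP cn maxn] := ex_maxnP exP ubP.
by case: (noS n); split=> // k ck; apply: maxn; apply/asboolP.
Qed.

Lemma len_chain B A : submod B -> B `<=` A -> chain B A (len B A).
Proof. by move=> hB BA; apply: (lenP hB BA).1. Qed.

Lemma len_max B A k : submod B -> chain B A k -> (k <= len B A)%N.
Proof. by move=> hB c; apply: (lenP hB (chain_sub c)).2. Qed.

Lemma len_add B K A : submod B -> submod K -> submod A ->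
  B `<=` K -> K `<=` A -> len B A = (len B K + len K A)%N.
Proof.
move=> hB hK hA BK KA; have BA : B `<=` A by move=> x /BK /KA.
apply/eqP; rewrite eqn_leq; apply/andP; split; last first.
  by apply: len_max => //; apply: chain_cat; apply: len_chain.
have [n1 [n2 [le_n c1 c2]]] := chain_split hK hA BK (len_chain hB BA).
apply: leq_trans le_n _; apply: leq_add; apply: len_max => //.
  by apply: (chain_subr _ c1) => x [].
by apply: (chain_subr _ c2); apply: addset_sub.
Qed.

Lemma len_mono B B' A A' : submod B -> submod B' -> B `<=` B' -> B' `<=` A' ->
  A' `<=` A -> (len B' A' <= len B A)%N.
Proof.
move=> hB hB' BB' BA' AA'; apply: len_max => //.
exact: chain_subr AA' (chain_subl BB' (len_chain hB' BA')).
Qed.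

Lemma len_refl A : submod A -> len A A = 0%N.
Proof. by move=> hA; have /eqP := @len_add A A A hA hA hA (fun=> id) (fun=> id);
  rewrite -[X in X == _]addn0 eqn_add2l => /eqP. Qed.

Lemma len_eq0 B A : submod A -> submod B -> B `<=` A -> len B A = 0%N -> A `<=` B.
Proof.
move=> hA hB BA l0; apply: contrapT => nAB.
have : chain B A 1 by exists B; split.
by move=> /(len_max hB); rewrite l0.
Qed.

End Chains.

Section Maps.
Context {V W : lmodType R} (f : {linear V -> W}).

(** If f x lies in f C + B, then x differs from an element of C by an element of A0 mapped into B,
    and the chain already contains all of these. Hence strict steps stay strict under images modulo
    [B]. *)
Lemma chain_preimage (A0 A : set V) (B : set W) n :
  submod A0 -> submod B -> submod A -> A `<=` A0 ->
  chain (A0 `&` f @^-1` B) A n -> chain B (addset (f @` A) B) n.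
Proof.
move=> hA0 hB; elim: n A => [|n IH] A hA AA0 /=.
  by move=> _; apply: addset_subr; apply: submod_image.
move=> [C [hC cC [CA nAC]]]; have CA0 : C `<=` A0 by move=> x /CA /AA0.
exists (addset (f @` C) B); split; [|exact: IH|split].
- by apply: submod_addset => //; apply: submod_image.
- by apply: addset_mono => _ [x Cx <-]; exists x => //; apply: CA.
move=> AC; apply: nAC => x Ax.
have [|_ [z [[c Cc <-] Bz fxE]]] := AC (f x).
  by apply: addset_subl => //; exists x.
rewrite -[x](subrK c); apply: submod_D => //; apply: (chain_sub cC); split.
  by apply: submod_B => //; [apply: AA0|apply: CA0].
by rewrite /preimage /= linearB fxE addrC addKr.
Qed.

(** Modulo [B] every element of A' is hit by [A], so a step that collapsed after taking preimages
    would have collapsed before. *)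
Lemma chain_image (A : set V) (B A' A1 : set W) n :
  submod A -> submod A1 -> A' `<=` addset (f @` A) B -> A1 `<=` A' ->
  chain B A1 n -> chain (A `&` f @^-1` B) (A `&` f @^-1` A1) n.
Proof.
move=> hA + A'B; elim: n A1 => [|n IH] A1 hA1 A1A' /=.
  by move=> BA1 x [Ax fx]; split=> //; apply: BA1.
move=> [C [hC cC [CA nAC]]]; exists (A `&` f @^-1` C); split.
- by apply: submod_setI => //; apply: submod_preimage.
- by apply: IH => // x /CA /A1A'.
split=> [x [Ax fx]|AC]; first by split=> //; apply: CA.
apply: nAC => y A1y; have [_ [z [[x Ax <-] Bz yE]]] := A'B _ (A1A' _ A1y).
have Cz : C z by apply: (chain_sub cC).
rewrite yE; apply: submod_D => //; apply: (AC _ _).2; split=> //.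
rewrite /preimage /= -[f x](addrK z) -yE; apply: submod_B => //; exact: CA.
Qed.

End Maps.
End Length.

Section LengthMaps.
Context {R : comNzRingType} {V W : lmodType R} (f : {linear V -> W}).
Hypotheses (fV : finite_length V) (fW : finite_length W).

(** A/K is a quotient of A/(A ∩ f^-1 B), which embeds into A'/B. *)
Lemma len_preimage_le (K A : set V) (B A' : set W) :
  submod K -> submod A -> submod B -> submod A' -> K `<=` A -> B `<=` A' ->
  (forall x, A x -> A' (f x)) -> (forall x, A x -> B (f x) -> K x) ->
  (len K A <= len B A')%N.
Proof.
move=> hK hA hB hA' KA BA fA fB; apply: len_max => //.
apply: (@chain_subr _ _ _ (addset (f @` A) B)).
  by apply: addset_sub => // _ [x Ax <-]; apply: fA.
apply: (@chain_preimage _ _ _ _ A) => //.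
by apply: (@chain_subl _ _ K); [move=> x []; apply: fB|apply: len_chain].
Qed.

(** A'/B is a subquotient of A/K: [f] maps A ∩ f^-1 A' onto it and kills K. *)
Lemma len_image_le (K A : set V) (B A' : set W) :
  submod K -> submod A -> submod B -> submod A' -> K `<=` A -> B `<=` A' ->
  (forall x, K x -> B (f x)) ->
  (forall y, A' y -> exists2 x, A x & B (y - f x)) ->
  (len B A' <= len K A)%N.
Proof.
move=> hK hA hB hA' KA BA fK fA; apply: len_max => //.
apply: (@chain_subr _ _ _ (A `&` f @^-1` A')); first by move=> x [].
apply: (@chain_subl _ _ (A `&` f @^-1` B)).
  by move=> x Kx; split; [apply: KA|apply: fK].
apply: (@chain_image _ _ _ _ _ _ A') => //; last by apply: len_chain.
move=> y /fA [x Ax Bx]; exists (f x), (y - f x); split=> //. 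
by rewrite addrC subrK.
Qed.

End LengthMaps.

Section Product.
Context {R : comNzRingType} {V W : lmodType R} {T : finType}.
Variables (pr : T -> {linear W -> V}) (inj : T -> {linear V -> W}).
Hypotheses (prK : forall t x, pr t (inj t x) = x)
  (pr0 : forall t u x, t != u -> pr u (inj t x) = 0)
  (pr_inj : forall x, (forall t, pr t x = 0) -> x = 0).

(** Coordinates stay abstract because matrices are decomposed in two ways, into entries and into
    rows. *)
Definition prodset (P : set V) : set W := [set x | forall t, P (pr t x)].

Lemma submod_prodset P : submod P -> submod (prodset P).
Proof.
move=> hP; split=> [t|a x y Px Py t]; first by rewrite linear0; case: hP.
by rewrite linearP; apply: hP.2.
Qed.

(** Interpolates between the product of copies of P (for empty [s]) and that of copies of P' (for
    full [s]). Enlarging [s] by one new coordinate costs one copy of P/P'. *)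
Definition mixset (s : seq T) (P' P : set V) : set W :=
  [set x | forall t, P (pr t x) /\ (t \in s -> P' (pr t x))].

Lemma submod_mixset s P' P : submod P' -> submod P -> submod (mixset s P' P).
Proof.
move=> hP' hP; split=> [t|a x y Px Py t].
  by rewrite linear0; split=> [|_]; [case: hP|case: hP'].
rewrite linearP; split; first by apply: hP.2; [case: (Px t)|case: (Py t)].
by move=> ts; apply: hP'.2; [apply: (Px t).2|apply: (Py t).2].
Qed.

Lemma mixset_cons t s P' P : mixset (t :: s) P' P `<=` mixset s P' P.
Proof.
move=> x Px u; have [Pu P'u] := Px u; split=> // us.
by apply: P'u; rewrite inE us orbT.
Qed.

Lemma mixset_nil P' P : mixset [::] P' P = prodset P.
Proof. by apply/seteqP; split=> x /= Px t; have := Px t; [case|]. Qed.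

Lemma mixset_enum (P' P : set V) : P' `<=` P -> mixset (enum T) P' P = prodset P'.
Proof.
move=> PP; apply/seteqP; split=> x /= Px t.
  by apply: (Px t).2; rewrite mem_enum.
by split; [apply: PP|].
Qed.

Lemma mixset_ker t s (P' P : set V) x :
  mixset s P' P x -> P' (pr t x) -> mixset (t :: s) P' P x.
Proof.
move=> Px P'x u; have [Pu P'u] := Px u; split=> //.
by rewrite inE => /orP [/eqP ->|].
Qed.

Lemma finite_length_prod : finite_length V -> finite_length W.
Proof.
move=> [N hN]; exists (#|T| * N)%N => n.
have -> : [set 0] = mixset (enum T) [set 0] setT.
  rewrite mixset_enum //; apply/seteqP; split=> [x -> t|x]; first by rewrite linear0.
  exact: pr_inj.
have -> : setT = mixset [::] [set 0] setT by rewrite mixset_nil; apply/seteqP; split.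
have hM s : submod (mixset s [set 0] setT).
  by apply: submod_mixset; [apply: submod_set0|apply: submod_setT].
rewrite cardE; elim: (enum T) n => [|t s IH] n.
  by case: n => //= n [C [_ /chain_sub AC [_ nAC]]].
move=> c; have [n1 [n2 [le_n c1 c2]]] :=
  chain_split (hM s) (hM [::]) (@mixset_cons t s _ _) c.
apply: leq_trans le_n _; rewrite mulSn; apply: leq_add; last first.
  apply: IH; apply: (chain_subr _ c2); apply: addset_sub => //.
have sI := submod_setI (hM [::]) (hM s).
have sIK : mixset [::] [set 0] setT `&` mixset s [set 0] setT
    `<=` mixset s [set 0] setT by move=> x [].
have cI : chain (mixset s [set 0] setT `&` pr t @^-1` [set 0])
    (mixset [::] [set 0] setT `&` mixset s [set 0] setT) n1.
  by apply: chain_subl c1 => x [Px fx]; apply: mixset_ker.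
apply: hN; apply: chain_subr (@subsetT _ _) (chain_preimage (hM s) (@submod_set0 _ V) sI sIK cI).
Qed.

Lemma len_prodset (P' P : set V) : finite_length V -> submod P' -> submod P ->
  P' `<=` P -> len (prodset P') (prodset P) = (#|T| * len P' P)%N.
Proof.
move=> fV hP' hP PP; have fW := finite_length_prod fV.
rewrite -(mixset_enum PP) -(mixset_nil P') cardE.
have hM s : submod (mixset s P' P) by apply: submod_mixset.
have sub0 s : mixset s P' P `<=` mixset [::] P' P by move=> x Px u; split; [case: (Px u)|].
elim: (enum T) (enum_uniq T) => [|t s IH] /=; first by rewrite len_refl.
move=> /andP [ts us]; rewrite (@len_add _ _ fW _ (mixset s P' P)) //; last first.
  exact: mixset_cons.
rewrite IH // mulSn; congr addn; apply/eqP; rewrite eqn_leq; apply/andP; split.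
  apply: (@len_preimage_le _ _ _ (pr t)) => //; first exact: mixset_cons.
    by move=> x /(_ t) [].
  by move=> x; apply: mixset_ker.
apply: (@len_preimage_le _ _ _ (inj t)) => //; first exact: mixset_cons.
- move=> x Px u; have [<-|tu] := eqVneq t u; first by rewrite prK (negbTE ts).
  by rewrite pr0 //; split=> [|_]; [case: hP|case: hP'].
- by move=> x _ /(_ t) [_]; rewrite prK; apply; rewrite mem_head.
Qed.

End Product.

(** * Lengths of modules of matrices *)

Section Matrices.
Context {R : comNzRingType}.

Definition entries {p q} (I : set R) : set 'M[R]_(p, q) :=
  [set X | forall i j, I (X i j)].
Definition rows_in {p q} (P : set 'rV[R]_q) : set 'M[R]_(p, q) :=
  [set X | forall i, P (row i X)].

Definition coord_fun {p q} (t : 'I_p * 'I_q) (X : 'M[R]_(p, q)) : R^o := X t.1 t.2.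
Lemma coord_fun_linear p q t : linear (@coord_fun p q t).
Proof. by move=> a X Y; rewrite /coord_fun !mxE. Qed.
HB.instance Definition _ p q t := GRing.isLinear.Build R 'M[R]_(p, q) R^o _
  (@coord_fun p q t) (@coord_fun_linear p q t).

Definition delta_fun {p q} (t : 'I_p * 'I_q) (a : R^o) : 'M[R]_(p, q) :=
  a *: delta_mx t.1 t.2.
Lemma delta_fun_linear p q t : linear (@delta_fun p q t).
Proof. by move=> a x y; rewrite /delta_fun scalerDl scalerA. Qed.
HB.instance Definition _ p q t := GRing.isLinear.Build R R^o 'M[R]_(p, q) _
  (@delta_fun p q t) (@delta_fun_linear p q t).

Definition col_delta_fun {p q} (t : 'I_p) (v : 'rV[R]_q) : 'M[R]_(p, q) :=
  delta_mx t 0 *m v.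
Lemma col_delta_fun_linear p q t : linear (@col_delta_fun p q t).
Proof. by move=> a x y; rewrite /col_delta_fun mulmxDr scalemxAr. Qed.
HB.instance Definition _ p q t := GRing.isLinear.Build R 'rV[R]_q 'M[R]_(p, q) _
  (@col_delta_fun p q t) (@col_delta_fun_linear p q t).

Section Entries.
Variables p q : nat.
Let pr (t : 'I_p * 'I_q) : {linear 'M[R]_(p, q) -> R^o} := coord_fun t.
Let inj (t : 'I_p * 'I_q) : {linear R^o -> 'M[R]_(p, q)} := delta_fun t.

Let prK t x : pr t (inj t x) = x.
Proof. by rewrite /= /coord_fun /delta_fun !mxE !eqxx mulr1. Qed.

Let pr0 t u x : t != u -> pr u (inj t x) = 0.
Proof.
rewrite eq_sym -pair_eqE /= => /negbTE tu.
by rewrite /coord_fun /delta_fun !mxE tu mulr0.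
Qed.

Let pr_inj x : (forall t, pr t x = 0) -> x = 0.
Proof. by move=> x0; apply/matrixP=> i j; have := x0 (i, j); rewrite mxE. Qed.

Lemma finite_length_mx : finite_length R^o -> finite_length 'M[R]_(p, q).
Proof. exact: (finite_length_prod pr_inj). Qed.

Let prodE (I : set R^o) : prodset pr I = entries I.
Proof. by apply/seteqP; split=> [x Ix i j|x Ix [i j]]; [apply: (Ix (i, j))|apply: Ix]. Qed.

Lemma submod_entries (I : set R^o) : submod I -> submod (@entries p q I).
Proof. by rewrite -prodE; apply: submod_prodset. Qed.

Lemma len_entries (I J : set R^o) : finite_length R^o -> submod I -> submod J ->
  I `<=` J -> len (@entries p q I) (entries J) = (p * q * len I J)%N.
Proof.
move=> fR hI hJ IJ; rewrite -!prodE (len_prodset prK pr0) //.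
by rewrite card_prod !card_ord.
Qed.

End Entries.

Section Rows.
Variables p q : nat.
Let pr (t : 'I_p) : {linear 'M[R]_(p, q) -> 'rV[R]_q} := row t.
Let inj (t : 'I_p) : {linear 'rV[R]_q -> 'M[R]_(p, q)} := col_delta_fun t.

Let prK t x : pr t (inj t x) = x.
Proof.
rewrite /= /col_delta_fun row_mul rowE mul_delta_mx.
by apply/rowP=> j; rewrite !mxE big_ord1 !mxE mul1r.
Qed.

Let pr0 t u x : t != u -> pr u (inj t x) = 0.
Proof.
move=> tu; rewrite /= /col_delta_fun row_mul rowE mul_delta_mx_cond eq_sym.
by rewrite (negbTE tu) mul0mx.
Qed.

Let pr_inj x : (forall t, pr t x = 0) -> x = 0.
Proof. by move=> x0; apply/row_matrixP=> i; rewrite row0; apply: x0. Qed.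

Lemma submod_rows_in (P : set 'rV[R]_q) : submod P -> submod (@rows_in p q P).
Proof. exact: (@submod_prodset _ _ _ _ pr). Qed.

Lemma len_rows_in (P' P : set 'rV[R]_q) : finite_length R^o -> submod P' -> submod P ->
  P' `<=` P -> len (@rows_in p q P') (rows_in P) = (p * len P' P)%N.
Proof.
move=> fR hP' hP PP; rewrite (len_prodset prK pr0) // ?card_ord //.
exact: finite_length_mx.
Qed.

End Rows.
End Matrices.

(** * The maximal ideal and its powers *)

Section Spans.
Context {R : comNzRingType} {V : lmodType R}.
Implicit Types A B K : set V.

Definition line (x : V) : set V := [set y | exists a, y = a *: x].

Lemma submod_line x : submod (line x).
Proof.
split; first by exists 0; rewrite scale0r.
by move=> a _ _ [b ->] [c ->]; exists (a * b + c); rewrite scalerDl scalerA.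
Qed.

(** Finiteness must be known before [len] has a meaning; this relative form passes through
    filtrations. *)
Definition bounded_chains B A := exists N, forall n, chain B A n -> (n <= N)%N.

Lemma bounded_chains_trans B K A : submod K -> submod A -> B `<=` K -> K `<=` A ->
  bounded_chains B K -> bounded_chains K A -> bounded_chains B A.
Proof.
move=> hK hA BK KA [N1 h1] [N2 h2]; exists (N1 + N2)%N => n c.
have [n1 [n2 [le_n c1 c2]]] := chain_split hK hA BK c.
apply: leq_trans le_n _; apply: leq_add.
  by apply: h1; apply: (chain_subr _ c1) => x [].
by apply: h2; apply: (chain_subr _ c2); apply: addset_sub.
Qed.

End Spans.

Section MaximalIdeal.
Context {R : comNzRingType} (m : set R).
Hypothesis m_max : maximal_ideal m.

Lemma submod_m : submod (m : set R^o).
Proof. by have [[m0 hm] _ _] := m_max; split. Qed.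

Lemma maximal_inv a : ~ m a -> exists r, m (1 - r * a).
Proof.
move=> nma; have [[m0 hm] mT maxm] := m_max.
pose J : set R := addset (m : set R^o) (line (a : R^o)).
have hJ : submod (J : set R^o) by apply: submod_addset; [apply: submod_m|apply: submod_line].
have mJ : m `<=` J by apply: (@addset_subl _ R^o); apply: submod_line.
have [JE|JE] := maxm J hJ mJ.
  exfalso; apply: nma; rewrite -JE; exists 0, a; rewrite add0r; split=> //.
  by exists 1; rewrite scale1r.
have : J 1 by rewrite JE.
move=> [y [_ [my [r ->] E]]]; exists r; rewrite E.
by rewrite -[r *: (a : R^o)]/(r * a) addrK.
Qed.

Lemma maximal_1 : ~ m 1.
Proof.
move=> m1; have [_ mT _] := m_max; apply: mT; apply/seteqP; split=> // a _.
by have := submod_Z submod_m a m1; rewrite -[a *: (1 : R^o)]/(a * 1) mulr1.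
Qed.

Section Vector.
Context {V : lmodType R}.
Implicit Types A B K : set V.

Lemma line_residue B x c : submod B -> (forall a, m a -> B (a *: x)) ->
  B (c *: x) -> ~ B x -> m c.
Proof.
move=> hB mxB Bcx nBx; apply: contrapT => /maximal_inv [r mr]; apply: nBx.
have -> : x = (1 - r * c) *: x + r *: (c *: x) by rewrite scalerA -scalerDl subrK scale1r.
by apply: submod_D => //; [apply: mxB|apply: submod_Z].
Qed.

Lemma chain_line B A x n : submod B -> submod A -> (forall a, m a -> B (a *: x)) ->
  A `<=` addset B (line x) -> chain B A n -> (n <= 1)%N.
Proof.
move=> hB hA mxB AB; case: n => [|[|n]] // [C [hC [D [hD cD [DC nCD]]] [CA nAC]]].
exfalso; apply: nCD => y Cy.
have BD := chain_sub cD.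
have [z [_ [Bz [c ->] yE]]] := AB _ (CA _ Cy).
rewrite yE; apply: submod_D => //; first exact: BD.
have Ccx : C (c *: x).
  by rewrite -[c *: x](addKr z) -yE addrC; apply: submod_B => //; apply: DC; apply: BD.
have [Cx|nCx] := pselect (C x).
  exfalso; apply: nAC => w /AB [z' [_ [Bz' [c' ->] ->]]].
  by apply: submod_D => //; [apply: DC; apply: BD|apply: submod_Z].
apply: (BD); apply: (mxB); apply: (line_residue hC _ Ccx nCx) => a ma.
by apply: DC; apply: BD; apply: mxB.
Qed.

Lemma bounded_chains_span B A n (g : 'I_n -> V) : submod B -> submod A ->
  B `<=` A -> (forall i, A (g i)) ->
  (forall a i, m a -> B (a *: g i)) ->
  (forall x, A x -> exists c : 'I_n -> R, B (x - \sum_i c i *: g i)) ->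
  bounded_chains B A.
Proof.
elim: n g B => [|n IH] g B hB hA BA Ag mB AB.
  exists 0%N => -[|k] // [C [_ /chain_sub BC [_ nAC]]]; exfalso; apply: nAC => x /AB.
  by move=> [c]; rewrite big_ord0 subr0 => /BC.
pose K := addset B (line (g ord0)).
have hK : submod K by apply: submod_addset => //; apply: submod_line.
have BK : B `<=` K by apply: addset_subl; apply: submod_line.
have KA : K `<=` A by apply: addset_sub => // _ [a ->]; apply: submod_Z.
apply: (@bounded_chains_trans _ _ _ K) => //.
  by exists 1%N => k; apply: (@chain_line B K (g ord0)) => // a ma; apply: mB.
apply: (IH (fun i => g (lift ord0 i))) => //.
  by move=> a i ma; apply: BK; apply: mB.
move=> x /AB [c]; rewrite big_ord_recl opprD addrA addrAC => Bx.
exists (fun i => c (lift ord0 i)).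
rewrite -[X in K X](subrK (c ord0 *: g ord0)).
by exists (x - \sum_(i < n) c (lift ord0 i) *: g (lift ord0 i) - c ord0 *: g ord0),
  (c ord0 *: g ord0); split=> //; exists (c ord0).
Qed.

Hypothesis fV : finite_length V.

Lemma len_line B A x : submod B -> submod A -> (forall a, m a -> B (a *: x)) ->
  A `<=` addset B (line x) -> B `<=` A -> A x -> ~ B x -> len B A = 1%N.
Proof.
move=> hB hA mxB AB BA Ax nBx; apply/eqP; rewrite eqn_leq; apply/andP; split.
  by apply: (chain_line hB hA mxB AB); apply: len_chain.
by apply: len_max => //; exists B; split=> //; split=> // /(_ _ Ax).
Qed.

(** As m kills A/B, any x outside B spans a line of length 1 modulo B; the remaining basis vectors
    come from A modulo that line. *)
Lemma len_has_kdim B A : submod B -> submod A -> B `<=` A ->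
  (forall a x, m a -> A x -> B (a *: x)) -> has_kdim m A B (len B A).
Proof.
move nE : (len B A) => n; elim: n B nE => [|n IH] B lBA hB hA BA mAB.
  exists (fun=> 0); split=> [[] //|x Ax|c _ []//].
  by exists (fun=> 0); rewrite big_ord0 subr0; apply: len_eq0 lBA _ Ax.
have [x Ax nBx] : exists2 x, A x & ~ B x.
  apply: contrapT => nx; suff AB : A `<=` B.
    by move: lBA; have -> : A = B by [apply/seteqP; split]; rewrite len_refl.
  by move=> x Ax; apply: contrapT => nBx; apply: nx; exists x.
pose K := addset B (line x).
have hK : submod K by apply: submod_addset => //; apply: submod_line.
have BK : B `<=` K by apply: addset_subl; apply: submod_line.
have KA : K `<=` A by apply: addset_sub => // _ [a ->]; apply: submod_Z.
have Kx : K x by apply: addset_subr => //; exists 1; rewrite scale1r.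
have mxB a : m a -> B (a *: x) by move=> ma; apply: mAB.
have lBK : len B K = 1%N by apply: len_line mxB _ _ _ _.
have [v [Av genv freev]] : has_kdim m A K n.
  apply: IH => //; last by move=> a y ma Ay; apply: BK; apply: mAB.
  by move: lBA; rewrite (len_add fV hB hK hA) // lBK add1n => -[].
exists (fun i => if unlift ord0 i is Some j then v j else x); split.
- by move=> i; case: (unlift _ _).
- move=> y /genv [c [z [_ [Bz [a ->] yE]]]].
  exists (fun i => if unlift ord0 i is Some j then c j else a).
  rewrite big_ord_recl unlift_none.
  under eq_bigr do rewrite liftK.
  by rewrite opprD addrCA yE addrC addrK.
- move=> c; rewrite big_ord_recl unlift_none.
  under eq_bigr do rewrite liftK.
  move=> Bc.
  have mc j : m (c (lift ord0 j)).
    apply: (freev (fun j => c (lift ord0 j))).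
    have := BK _ Bc; rewrite addrC => Kc.
    rewrite -[X in K X](addrK (c ord0 *: x)); apply: submod_B => //.
    exact: submod_Z.
  have Bs : B (\sum_(i < n) c (lift ord0 i) *: v i).
    by apply: submod_sum => // i; apply: mAB.
  have Bcx : B (c ord0 *: x).
    rewrite -[X in B X](addrK (\sum_(i < n) c (lift ord0 i) *: v i)).
    exact: submod_B.
  move=> i; case: (unliftP ord0 i) => [j|] ->; first exact: mc.
  exact: line_residue mxB Bcx nBx.
Qed.

Lemma has_kdim_len B A n : submod B -> submod A -> B `<=` A ->
  (forall a x, m a -> A x -> B (a *: x)) -> has_kdim m A B n -> len B A = n.
Proof.
elim: n B => [|n IH] B hB hA BA mAB [v [Av genv freev]].
  suff -> : A = B by rewrite len_refl.
  by apply/seteqP; split=> // x /genv [c]; rewrite big_ord0 subr0.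
pose x := v ord0; pose K := addset B (line x).
have hK : submod K by apply: submod_addset => //; apply: submod_line.
have BK : B `<=` K by apply: addset_subl; apply: submod_line.
have KA : K `<=` A by apply: addset_sub => // _ [a ->]; apply: submod_Z => //; apply: Av.
have Kx : K x by apply: addset_subr => //; exists 1; rewrite scale1r.
have mxB a : m a -> B (a *: x) by move=> ma; apply: mAB => //; apply: Av.
have nBx : ~ B x.
  move=> Bx; apply: maximal_1.
  have := freev (fun i => (i == ord0)%:R) _ ord0; rewrite eqxx; apply.
  rewrite (bigD1 ord0) //= scale1r big1 ?addr0 // => i /negbTE ->.
  by rewrite scale0r.
rewrite (len_add fV hB hK hA) // (len_line hB hK mxB) // (IH K) //.
  by move=> a y ma Ay; apply: BK; apply: mAB.
exists (fun j => v (lift ord0 j)); split=> //.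
  move=> y /genv [c]; rewrite big_ord_recl => By.
  exists (fun j => c (lift ord0 j)).
  exists (y - (c ord0 *: v ord0 + \sum_(i < n) c (lift ord0 i) *: v (lift ord0 i))),
    (c ord0 *: x); split=> //; first by exists (c ord0).
  by rewrite opprD addrA addrAC subrK.
move=> c [z [_ [Bz [a ->] cE]]] j.
have := freev (fun i => if unlift ord0 i is Some j then c j else - a) _ (lift ord0 j).
rewrite liftK; apply; rewrite big_ord_recl unlift_none.
under eq_bigr do rewrite liftK.
by rewrite cE scaleNr addrC addrK.
Qed.

End Vector.

Local Notation mp := (ideal_pow m).

Lemma submod_smul (V : lmodType R) (I : set R) (A : set V) :
  submod (I : set R^o) -> submod A -> submod (ideal_smul I A).
Proof.
move=> hI hA; split.
  by exists 0%N, (fun=> 0), (fun=> 0); split=> [[]//|]; rewrite big_ord0.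
move=> a _ _ [n1 [c1 [x1 [h1 ->]]]] [n2 [c2 [x2 [h2 ->]]]].
exists (n1 + n2)%N,
  (fun i : 'I_(n1 + n2) => match fintype.split i with inl j => a * c1 j | inr j => c2 j end),
  (fun i : 'I_(n1 + n2) => match fintype.split i with inl j => x1 j | inr j => x2 j end); split.
  move=> i; case: (fintype.split i) => j; last exact: h2.
  by split; [apply: (submod_Z hI); apply: (h1 j).1|apply: (h1 j).2].
rewrite big_split_ord /= scaler_sumr; congr (_ + _); apply: eq_bigr => i _.
  by rewrite (unsplitK (inl i)) scalerA.
by rewrite (unsplitK (inr i)).
Qed.

Lemma submod_pow n : submod (mp n : set R^o).
Proof.
elim: n => [|n IH]; first exact: submod_setT.
by apply: submod_smul => //; apply: submod_m.
Qed.

Lemma mem_smul (V : lmodType R) (I : set R) (A : set V) a x :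
  I a -> A x -> ideal_smul I A (a *: x).
Proof. by move=> Ia Ax; exists 1%N, (fun=> a), (fun=> x); rewrite big_ord1. Qed.

Lemma pow_mulm n a x : m a -> mp n x -> mp n.+1 (a * x).
Proof. exact: (@mem_smul R^o). Qed.

Lemma smul_ind (V : lmodType R) (I : set R) (A P : set V) : submod P ->
  (forall a x, I a -> A x -> P (a *: x)) -> ideal_smul I A `<=` P.
Proof.
move=> hP IP _ [n [a [x [h ->]]]]; apply: submod_sum => // i.
by apply: IP; case: (h i).
Qed.

Lemma pow_1 : mp 1 = m.
Proof.
apply/seteqP; split=> [|a ma]; last by rewrite -[a]mulr1; apply: pow_mulm.
apply: (@smul_ind R^o); first exact: submod_m.
by move=> a x ma _; rewrite -[a *: (x : R^o)]/(a * x) mulrC; apply: (submod_Z submod_m).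
Qed.

Lemma pow_S n : mp n.+1 `<=` mp n.
Proof.
apply: (@smul_ind R^o); first exact: submod_pow.
by move=> a x _ mx; apply: (submod_Z (submod_pow n)).
Qed.

Lemma pow_le p q : (p <= q)%N -> mp q `<=` mp p.
Proof.
move=> /subnK <-; elim: (q - p)%N => [|k IH] // x; rewrite addSn => /pow_S; exact: IH.
Qed.

Lemma pow_mul p q a x : mp p a -> mp q x -> mp (p + q) (a * x).
Proof.
move=> mpa mqx; elim: p a mpa => [|p IH] a /=.
  by move=> _; apply: (submod_Z (submod_pow q)).
move=> [n [c [y [h ->]]]]; rewrite mulr_suml.
apply: (@submod_sum _ R^o _ (submod_pow (p.+1 + q))) => i.
rewrite -mulrA; apply: pow_mulm; first by case: (h i).
by apply: IH; case: (h i).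
Qed.

(** Translates products of an ideal with a free module into conditions on matrix entries, the
    language of all later computations. *)
Lemma smul_entries n (I : set R) : submod (I : set R^o) ->
  ideal_smul I setT = @entries R 1 n I.
Proof.
move=> hI; apply/seteqP; split.
  apply: smul_ind; first exact: submod_entries.
  move=> a x Ia _ i j; rewrite mxE mulrC; exact: (submod_Z hI).
move=> x Ix; rewrite (row_sum_delta x).
apply: submod_sum => [|j]; last by apply: mem_smul.
by apply: submod_smul => //; apply: submod_setT.
Qed.

Hypothesis m4 : mp 4 = [set 0].

Lemma pow_ge4 n : (4 <= n)%N -> mp n = [set 0].
Proof.
move=> /pow_le; rewrite m4 => mn; apply/seteqP; split=> // _ ->.
exact: (submod_0 (submod_pow n)).
Qed.

(** Each layer m^n/m^(n+1) is finitely generated and killed by m, so its chains are bounded, and m^4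
    = 0 leaves only four layers. *)
Lemma finite_length_ring : noetherian R -> finite_length R^o.
Proof.
move=> noeth; rewrite /finite_length -[[set 0]]m4.
suff H n : bounded_chains (mp n : set R^o) setT by exact: H.
elim: n => [|n IH].
  by exists 0%N => -[|k] // [C [_ /chain_sub AC [_ nAC]]].
have hI : is_ideal (mp n) by apply: submod_pow.
apply: (@bounded_chains_trans _ R^o _ (mp n)) ; [exact: submod_pow|exact: submod_setT|exact: pow_S|by []|idtac|exact: IH].
have [k [g gE]] := noeth _ hI.
have mg i : mp n (g i).
  rewrite gE; exists (fun j => (j == i)%:R); rewrite (bigD1 i) //= eqxx mul1r.
  by rewrite big1 ?addr0 // => j /negbTE ->; rewrite mul0r.
apply: (@bounded_chains_span R^o _ _ k g) => //; try exact: submod_pow.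
- exact: pow_S.
- by move=> a i ma; apply: pow_mulm.
move=> x; rewrite gE => -[c ->]; exists c; rewrite subrr.
exact: (submod_0 (submod_pow n.+1)).
Qed.

End MaximalIdeal.

(** * Syzygies in an eventually linear resolution *)

Lemma mx_rows_ex {R : comNzRingType} p q r (X : 'M[R]_(p, q)) (Y : 'M[R]_(r, q)) :
  (forall k, exists w, row k X = w *m Y) -> exists W, X = W *m Y.
Proof.
move=> /choice [w hw]; exists (\matrix_k w k); apply/row_matrixP => k.
by rewrite row_mul rowK hw.
Qed.

Section EntryProducts.
Context {R : comNzRingType} (m : set R).
Hypothesis m_max : maximal_ideal m.
Local Notation mp := (ideal_pow m).

Lemma entries_pow_mul p q u v w (X : 'M[R]_(u, v)) (Y : 'M[R]_(v, w)) :
  entries (mp p) X -> entries (mp q) Y -> entries (mp (p + q)) (X *m Y).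
Proof.
move=> hX hY i j; rewrite mxE.
by apply: (@submod_sum _ R^o _ (submod_pow m_max _)) => k; apply: pow_mul.
Qed.

Lemma entries_mul (I : set R) u v w (X : 'M[R]_(u, v)) (Y : 'M[R]_(v, w)) :
  submod (I : set R^o) -> entries I X -> entries I (X *m Y).
Proof.
move=> hI hX i j; rewrite mxE.
apply: (@submod_sum _ R^o _ hI) => k; rewrite mulrC; exact: (submod_Z hI).
Qed.

Lemma submod_entries_pow u v q : submod (@entries R u v (mp q)).
Proof. by apply: submod_entries; apply: submod_pow. Qed.

Lemma entries_pow_S u v q : @entries R u v (mp q.+1) `<=` entries (mp q).
Proof. by move=> X hX i j; apply: (pow_S m_max). Qed.

Lemma len_m_ring : finite_length R^o -> len (m : set R^o) setT = 1%N.
Proof.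
move=> fR; apply: (len_line m_max fR (x := 1 : R^o)) => //.
- exact: submod_m.
- by move=> a ma; rewrite -[a *: (1 : R^o)]/(a * 1) mulr1.
- move=> a _; exists 0, a; split; [exact: (submod_0 (submod_m m_max))| |by rewrite add0r].
  by exists a; rewrite -[a *: (1 : R^o)]/(a * 1) mulr1.
- exact: maximal_1 m_max.
Qed.

End EntryProducts.

Section Syzygies.
Context {R : comNzRingType} (m : set R).
Hypothesis m_max : maximal_ideal m.
Local Notation mp := (ideal_pow m).
Context {M : lmodType R} (F : free_resolution M).
Hypothesis F_min : minimal F m.
Local Notation b := (rk F).
Local Notation A := (dmx F).

Lemma dmx_entries i : entries m (A i).
Proof.
move=> k l; have := F_min (delta_mx 0 k : 'rV_(b i.+1)).
rewrite (smul_entries _ (submod_m m_max)) -rowE => /(_ 0 l).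
by rewrite mxE.
Qed.

Lemma entries_dmx p q i (X : 'M[R]_(p, b i.+1)) :
  entries (mp q) X -> entries (mp q.+1) (X *m A i).
Proof.
rewrite -[q.+1]addn1 => hX; apply: entries_pow_mul => //.
by rewrite pow_1 //; apply: dmx_entries.
Qed.

Lemma dmx_dmx i : A i.+1 *m A i = 0.
Proof.
apply/row_matrixP=> k; rewrite row_mul row0; apply/exact_diff.
by exists (delta_mx 0 k); rewrite -rowE.
Qed.

Lemma matrix_exact p j (X : 'M[R]_(p, b j.+1)) : X *m A j = 0 ->
  exists Y, X = Y *m A j.+1.
Proof.
move=> XA; apply: mx_rows_ex => k.
by apply/exact_diff; rewrite -row_mul XA row0.
Qed.

Definition mul_dmx p i (X : 'M[R]_(p, b i.+1)) : 'M[R]_(p, b i) := X *m A i.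
Lemma mul_dmx_linear p i : linear (@mul_dmx p i).
Proof. by move=> a X Y; rewrite /mul_dmx mulmxDl scalemxAl. Qed.
HB.instance Definition _ p i := GRing.isLinear.Build R 'M[R]_(p, b i.+1) 'M[R]_(p, b i) _
  (@mul_dmx p i) (@mul_dmx_linear p i).

(* m^q S_j, where S_j is the image of [dmx F j]. *)
Definition syz q j : set 'rV[R]_(b j) :=
  [set v | exists2 x, entries (mp q) x & v = x *m A j].
Arguments syz : clear implicits.

Lemma syzE q j : syz q j = @mul_dmx 1 j @` entries (mp q).
Proof. by apply/seteqP; split=> [_ [x hx ->]|_ [x hx <-]]; exists x. Qed.

Lemma submod_syz q j : submod (syz q j).
Proof. by rewrite syzE; apply: submod_image; apply: submod_entries_pow. Qed.

Lemma syz_S q j : syz q.+1 j `<=` syz q j.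
Proof. by move=> _ [x hx ->]; exists x => //; apply: (entries_pow_S m_max). Qed.

Lemma syz_le p q j : (p <= q)%N -> syz q j `<=` syz p j.
Proof. by move=> pq _ [x hx ->]; exists x => // u v; apply: (pow_le m_max pq). Qed.

Lemma syz_entries q j : syz q j `<=` entries (mp q.+1).
Proof. by move=> _ [x hx ->]; apply: entries_dmx. Qed.

Lemma syz_eq0 q j : mp 4 = [set 0] -> (3 <= q)%N -> syz q j = [set 0].
Proof.
move=> m4 q3; apply/seteqP; split=> [v /syz_entries|_ ->]; last first.
  exact: submod_0 (submod_syz _ _).
by rewrite pow_ge4 // => v0; apply/matrixP=> i k; rewrite v0 mxE.
Qed.

Hypothesis fR : finite_length R^o.

(** The Hilbert function of the module S_j. *)
Definition sigma q j := len (syz q.+1 j) (syz q j).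

(** By minimality the kernel of F_(j+1) -> S_j lies in mF_(j+1), so both modules have the same
    minimal number of generators. *)
Lemma sigma_0 j : sigma 0 j = b j.+1.
Proof.
have fV p q : finite_length 'M[R]_(p, q) := finite_length_mx _ _ fR.
transitivity (len (@entries R 1 (b j.+1) m) (entries setT)); last first.
  rewrite (len_entries _ _ fR (submod_m m_max) (@submod_setT _ R^o)) //.
  by rewrite (len_m_ring m_max fR) muln1 mul1n.
have hm : submod (@entries R 1 (b j.+1) m).
  by rewrite -(pow_1 m_max); apply: submod_entries_pow.
have hT : submod (@entries R 1 (b j.+1) setT) by apply: (submod_entries_pow m_max _ _ 0).
have syzT x : syz 0 j (x *m A j) by exists x.
apply/eqP; rewrite eqn_leq; apply/andP; split.
  apply: (len_image_le (f := @mul_dmx 1 j) (fV _ _) (fV _ _)) => //; try exact: submod_syz.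
  - exact: syz_S.
  - by move=> x mx; exists x => //; rewrite pow_1.
  - by move=> _ [x _ ->]; exists x => //; rewrite subrr; exact: (submod_0 (submod_syz _ _)).
apply: (len_preimage_le (f := @mul_dmx 1 j) (fV _ _) (fV _ _)) => //; try exact: submod_syz.
- exact: syz_S.
- by move=> x _; exact: syzT.
- move=> x _ [y]; rewrite pow_1 // => my /eqP.
  rewrite -subr_eq0 -mulmxBl => /eqP /exact_diff [w xyE].
  rewrite -[x](subrK y) xyE; apply: (submod_D hm) => //.
  by rewrite -(pow_1 m_max); apply: (entries_dmx (q := 0)).
Qed.

Variable n : nat.
Hypothesis F_lin : gr_acyclic_from F m n.

(** In strand i + 1 the term of degree i + 1 is F/mF. Boundaries come from a negative power, which
    is all of R by convention, and lie in m by minimality. *)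
Lemma acyclic_0 i (x : 'rV[R]_(b i.+1)) : (n <= i.+1)%N ->
  entries (mp 2) (x *m A i) -> entries m x.
Proof.
move=> ni hx; have [] := F_lin ni (j := i.+1%:Z) (t := x).
  rewrite /cycles /grF; split.
    by rewrite subrr (smul_entries _ (submod_pow m_max 0)).
  have -> : i.+1%:Z + 1 - i%:Z = 2%:Z by lia.
  by rewrite (smul_entries _ (submod_pow m_max 2)).
move=> y [z [_ + ->]]; rewrite /grF addrAC subrr add0r.
rewrite (smul_entries _ (submod_pow m_max 1)) pow_1 // => mz.
have hm : submod (@entries R 1 (b i.+1) m) by apply: submod_entries (submod_m m_max).
apply: (submod_D hm) => //.
by rewrite -(pow_1 m_max); apply: (entries_dmx (q := 0)).
Qed.

Lemma acyclic_S i q (x : 'rV[R]_(b i.+1)) : (n <= i.+1)%N ->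
  entries (mp q.+1) x -> entries (mp q.+3) (x *m A i) ->
  exists y z, [/\ entries (mp q) y, entries (mp q.+2) z & x = y *m A i.+1 + z].
Proof.
move=> ni hx hxA; have [] := F_lin ni (j := (i.+1 + q.+1)%:Z) (t := x).
  rewrite /cycles /grF; split.
    have -> : (i.+1 + q.+1)%:Z - i.+1%:Z = q.+1%:Z by lia.
    by rewrite (smul_entries _ (submod_pow m_max _)).
  have -> : (i.+1 + q.+1)%:Z + 1 - i%:Z = q.+3%:Z by lia.
  by rewrite (smul_entries _ (submod_pow m_max _)).
move=> y [z [+ + ->]]; rewrite /grF.
have -> : (i.+1 + q.+1)%:Z - i.+2%:Z = q%:Z by lia.
have -> : (i.+1 + q.+1)%:Z + 1 - i.+1%:Z = q.+2%:Z by lia.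
rewrite !(smul_entries _ (submod_pow m_max _)) => hy hz.
by exists y, z.
Qed.

(** Linearity makes 0 -> m^q S_(j+1)/m^(q+1) S_(j+1) -> m^(q+1) F_(j+1)/m^(q+2) F_(j+1) -> m^(q+1)
    S_j/m^(q+2) S_j -> 0 exact. In the proof [K] is the preimage in m^(q+1) F_(j+1) of the kernel of
    the right-hand map. *)
Lemma sigma_rec q j : (n <= j.+1)%N ->
  (sigma q.+1 j + sigma q j.+1)%N =
  (b j.+1 * len (mp q.+2 : set R^o) (mp q.+1))%N.
Proof.
move=> nj.
have fV p k : finite_length 'M[R]_(p, k) := finite_length_mx _ _ fR.
have hE k : submod (@entries R 1 (b j.+1) (mp k)) by apply: submod_entries_pow.
pose K : set 'rV_(b j.+1) := entries (mp q.+1) `&` @mul_dmx 1 j @^-1` syz q.+2 j.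
have hK : submod K.
  by apply: submod_setI => //; apply: submod_preimage; apply: submod_syz.
have KE : K `<=` entries (mp q.+1) by move=> x [].
have EK : entries (mp q.+2) `<=` K.
  by move=> x hx; split; [apply: (entries_pow_S m_max)|exists x].
have := @len_entries _ 1 (b j.+1) (mp q.+2) (mp q.+1) fR (submod_pow m_max _)
  (submod_pow m_max _) (pow_S m_max (n:=_)).
rewrite mul1n => <-; rewrite (@len_add _ _ (fV _ _) _ K) // addnC; congr addn.
  apply/eqP; rewrite eqn_leq; apply/andP; split.
    apply: (len_preimage_le (f := idfun) (fV _ _) (fV _ _)) => //; try exact: submod_syz.
    - exact: syz_S.
    - move=> _ [y hy ->]; split; first by apply: entries_dmx.
      exists 0; first exact: submod_0 (submod_entries_pow _ _ _ _).
      by rewrite /mul_dmx /= -mulmxA dmx_dmx mulmx0 mul0mx.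
    (* Injectivity on the left. For q = 0 there is no smaller power of m to correct with, so
       [acyclic_0] takes the place of [acyclic_S]. *)
    - move=> _ [y hy ->] /= hyA; case: q hy hyA {K hK KE EK} => [|q] hy hyA.
        exists y => //; rewrite pow_1 //; apply: acyclic_0 hyA; exact: leqW.
      have [y' [z [_ hz ->]]] := acyclic_S (leqW nj) hy hyA.
      by exists z => //; rewrite mulmxDl -mulmxA dmx_dmx mulmx0 add0r.
  apply: (len_image_le (f := idfun) (fV _ _) (fV _ _)) => //; try exact: submod_syz.
  - exact: syz_S.
  - exact: syz_entries.
  - move=> x [hx [w hw /eqP]]; rewrite -subr_eq0 -mulmxBl => /eqP xw0.
    have hxw : entries (mp q.+1) (x - w).
      by apply: (submod_B (hE _)) => //; apply: (entries_pow_S m_max).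
    have [|y [z [hy hz xwE]]] := acyclic_S nj hxw.
      by rewrite xw0; exact: submod_0 (submod_entries_pow _ _ _ _).
    exists (y *m A j.+1); first by exists y.
    have -> : x - idfun (y *m A j.+1) = w + z.
      by rewrite -[x](subrK w) xwE /= addrC !addrA addNr add0r addrC.
    exact: (submod_D (hE _)).
apply/eqP; rewrite eqn_leq; apply/andP; split.
  apply: (len_image_le (f := @mul_dmx 1 j) (fV _ _) (fV _ _)) => //; try exact: submod_syz.
  - exact: syz_S.
  - by move=> x [].
  - by move=> _ [x hx ->]; exists x => //; rewrite subrr; exact: (submod_0 (submod_syz _ _)).
apply: (len_preimage_le (f := @mul_dmx 1 j) (fV _ _) (fV _ _)) => //; try exact: submod_syz.
- exact: syz_S.
- by move=> x hx; exists x.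
Qed.

Hypothesis m4 : mp 4 = [set 0].

Lemma sigma_3 j : sigma 3 j = 0%N.
Proof.
rewrite /sigma !syz_eq0 // len_refl //; first exact: finite_length_mx.
exact: submod_set0.
Qed.

End Syzygies.
Arguments syz {R} m {M} F q j _.

Section ScaleVector.
Context {R : comNzRingType} {V : lmodType R} (v : V).
Definition scale_vec (a : R^o) : V := a *: v.
Lemma scale_vec_linear : linear scale_vec.
Proof. by move=> a x y; rewrite /scale_vec scalerDl scalerA. Qed.
HB.instance Definition _ := GRing.isLinear.Build R R^o V _ scale_vec scale_vec_linear.
End ScaleVector.

Section LengthTelescope.
Context {R : comNzRingType} {V : lmodType R}.

Lemma len_telescope (Q : nat -> set V) n : finite_length V ->
  (forall t, submod (Q t)) -> (forall t, Q t `<=` Q t.+1) ->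
  len (Q 0%N) (Q n) = (\sum_(t < n) len (Q t) (Q t.+1))%N.
Proof.
move=> fV hQ QS; have Q0 t : Q 0%N `<=` Q t by elim: t => // t IH x /IH /QS.
elim: n => [|n IH]; first by rewrite big_ord0 len_refl.
by rewrite big_ord_recr /= -IH; apply: len_add.
Qed.

End LengthTelescope.

(** * A numerical consequence of linearity for N *)

Section RankBound.
Context {R : comNzRingType} (m : set R).
Hypotheses (m_max : maximal_ideal m) (fR : finite_length R^o).
Local Notation mp := (ideal_pow m).
Context {N : lmodType R} (F : free_resolution N).
Hypothesis F_min : minimal F m.
Variable n : nat.
Hypothesis F_lin : gr_acyclic_from F m n.
Local Notation b := (rk F).
Local Notation B := (dmx F).

Let fV p q : finite_length 'M[R]_(p, q) := finite_length_mx p q fR.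

Definition col_preimage (I : set R) i : set 'M[R]_(b i, 1) :=
  [set w | entries I (B i *m w)].
Arguments col_preimage : clear implicits.

Lemma submod_col_preimage (I : set R) i : submod (I : set R^o) ->
  submod (col_preimage I i).
Proof.
move=> hI; apply: (@submod_preimage _ _ _ (mulmx (B i)) (entries I)).
exact: submod_entries.
Qed.

(* By linearity, a row vector [x] with [x *m B] zero modulo m^2 vanishes modulo
   m; hence rows [x] modulo m embed into pairs: the values of [x *m B] modulo
   [I] on generators of the columns modulo [col_preimage I i], and, when these
   vanish, [x *m B] in I / m^2. *)
Lemma rank_bound (I : set R) i : submod (I : set R^o) -> mp 2 `<=` I -> I `<=` m ->
  (n <= i.+1)%N ->
  (b i.+1 <= len (col_preimage I i) setT * len (I : set R^o) m
             + b i * len (mp 2 : set R^o) I)%N.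
Proof.
move=> hI m2I Im ni; set q := len _ setT.
have hm := submod_m m_max; have hm2 := submod_pow m_max 2.
have hK := submod_col_preimage i hI.
have hBm k (w : 'M[R]_(b i, k)) : entries m w -> entries (mp 2) (B i *m w).
  rewrite -[in entries m](pow_1 m_max) => hw.
  apply: (@entries_pow_mul _ _ m_max 1 1) => //.
  by rewrite (pow_1 m_max); apply: dmx_entries.
have [v [_ genv _]] : has_kdim m setT (col_preimage I i) q.
  apply: (len_has_kdim m_max (fV _ _)) => // a x ma _ k l; apply: m2I; apply: hBm => s t.
  by rewrite mxE mulrC; apply: (submod_Z hm).
pose W : 'M[R]_(b i, q) := \matrix_(s, u) v u s 0.
have WE u : col u W = v u by apply/colP => s; rewrite !mxE.
pose X1 : set 'rV_(b i.+1) := [set x | entries I (x *m B i)].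
pose X2 : set 'rV_(b i.+1) := [set x | entries (mp 2) (x *m B i)].
have hX1 : submod X1 by apply: (@submod_preimage _ _ _ (mulmxr (B i)) (entries I)); apply: submod_entries.
have hX2 : submod X2 by apply: (@submod_preimage _ _ _ (mulmxr (B i)) (entries (mp 2))); apply: submod_entries.
have X21 : X2 `<=` X1 by move=> x hx s t; apply: m2I; apply: hx.
have hEm p k : submod (@entries R p k m) by apply: submod_entries.
have le1 : (len X1 setT <= q * len (I : set R^o) m)%N.
  have := @len_entries R 1 q I m fR hI hm Im; rewrite mul1n => <-.
  apply: (len_preimage_le (f := mulmxr (B i *m W)) (fV _ _) (fV _ _)) => //.
  - exact: submod_entries.
  - by move=> x hx s t; apply: Im; apply: hx.
  - move=> x _; rewrite /= -(pow_1 m_max); apply: (@entries_pow_mul _ _ m_max 0 1) => //.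
    rewrite (pow_1 m_max); apply: entries_mul => //; exact: dmx_entries.
  (* The columns of [W] generate all columns modulo [col_preimage]. Hence x B W in I forces x B w in
     I for every column w, and unit columns w give the entries of x B. *)
  move=> x _ /= hx s t; rewrite [s]ord1.
  have [c hc] := genv (delta_mx t 0 : 'cV[R]_(b i)) Logic.I.
  have xE (w : 'cV[R]_(b i)) k (Y : 'M[R]_(b i, k)) u : w = col u Y ->
      (x *m B i *m w) 0 0 = (x *m B i *m Y) 0 u.
    by move=> ->; rewrite colE mulmxA -colE mxE.
  have -> : (x *m B i) 0 t = (x *m B i *m (delta_mx t 0 : 'cV[R]_(b i))) 0 0.
    by rewrite (xE _ _ 1%:M t) ?mulmx1 // colE mul1mx.
  rewrite -[delta_mx t 0](subrK (\sum_(u < q) c u *: v u)) mulmxDr.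
  rewrite [X in I X]mxE; apply: (submod_D hI).
    by rewrite -mulmxA mxE; apply: (submod_sum hI) => k; apply: (submod_Z hI); apply: hc.
  rewrite mulmx_sumr summxE; apply: (submod_sum hI) => u.
  rewrite -scalemxAr mxE; apply: (submod_Z hI).
  by rewrite (xE _ _ W u) // -mulmxA; apply: hx.
have le2 : (len X2 X1 <= b i * len (mp 2 : set R^o) I)%N.
  have := @len_entries R 1 (b i) _ I fR hm2 hI m2I; rewrite mul1n => <-.
  apply: (len_preimage_le (f := mulmxr (B i)) (fV _ _) (fV _ _)) => //.
  - exact: submod_entries.
  - exact: submod_entries.
  - by move=> x hx s t; apply: m2I; apply: hx.
have X2m : X2 `<=` entries m.
  by move=> x; apply: (acyclic_0 m_max F_min F_lin).
have hT : submod (setT : set 'rV[R]_(b i.+1)) by apply: submod_setT.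
have -> : b i.+1 = len (entries m) (setT : set 'rV[R]_(b i.+1)).
  have -> : (setT : set 'rV[R]_(b i.+1)) = entries setT by apply/seteqP; split.
  rewrite (len_entries _ _ fR hm (@submod_setT _ R^o)) //.
  by rewrite (len_m_ring m_max fR) muln1 mul1n.
apply: (@leq_trans (len X2 setT)); first by apply: (len_mono (fV _ _) hX2 (hEm _ _) X2m).
by rewrite (@len_add _ _ (fV _ _) X2 X1) // addnC leq_add.
Qed.

End RankBound.
Arguments col_preimage {R N} F I i _.

(** * The complexes of homomorphisms into the syzygies *)

Section TwoResolutions.
Context {R : comNzRingType} (m : set R).
Hypotheses (m_max : maximal_ideal m) (fR : finite_length R^o).
Local Notation mp := (ideal_pow m).
Hypothesis m4 : mp 4 = [set 0].
Context {M N : lmodType R} (FM : free_resolution M) (FN : free_resolution N).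
Hypotheses (FM_min : minimal FM m) (FN_min : minimal FN m).
Local Notation A := (dmx FM).
Local Notation B := (dmx FN).
Local Notation a := (rk FM).
Local Notation b := (rk FN).

Let fV p q : finite_length 'M[R]_(p, q) := finite_length_mx p q fR.
Let hs q j : submod (syz m FM q j) := submod_syz m_max FM q j.

(* The complex Hom(FN, S_j): cochains in degree i, cocycles, and coboundaries in
   degree i + 1, for S_j the image of [dmx FM j]. *)
Definition cochains i j : set 'M[R]_(b i, a j) := rows_in (syz m FM 0 j).
Arguments cochains : clear implicits.
Definition hom_cocycles i j : set 'M[R]_(b i, a j) :=
  [set X | cochains i j X /\ B i *m X = 0].
Arguments hom_cocycles : clear implicits.
Definition hom_coboundaries i j : set 'M[R]_(b i.+1, a j) :=
  mulmx (B i) @` cochains i j.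
Arguments hom_coboundaries : clear implicits.

Lemma cochainsP i j X : cochains i j X <-> exists Y, X = Y *m A j.
Proof.
split=> [hX|[Y ->] k]; last by exists (row k Y) => //; rewrite row_mul.
by apply: mx_rows_ex => k; have [y _ E] := hX k; exists y.
Qed.

Lemma submod_cochains i j : submod (cochains i j).
Proof. exact: submod_rows_in. Qed.

Lemma submod_hom_cocycles i j : submod (hom_cocycles i j).
Proof.
apply: submod_setI; first exact: submod_cochains.
apply: (@submod_preimage _ _ _ (mulmx (B i)) [set 0]); exact: submod_set0.
Qed.

Lemma submod_hom_coboundaries i j : submod (hom_coboundaries i j).
Proof. by apply: (@submod_image _ _ _ (mulmx (B i))); apply: submod_cochains. Qed.

Lemma hom_coboundaries_cocycles i j : hom_coboundaries i j `<=` hom_cocycles i.+1 j.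
Proof.
move=> _ [_ /cochainsP [Y ->] <-]; split.
  by apply/cochainsP; exists (B i *m Y); rewrite mulmxA.
by rewrite mulmxA dmx_dmx mul0mx.
Qed.

(** The length of Ext^(i+1)(N, S_j). *)
Definition hom_defect i j : nat := len (hom_coboundaries i j) (hom_cocycles i.+1 j).

(* The sequence 0 -> S_(j+1) -> R^(a (j+1)) -> S_j -> 0 gives an isomorphism
   Ext^i(N, S_j) -> Ext^(i+1)(N, S_(j+1)) where Ext(N, R) vanishes. *)
Lemma hom_defect_S i j :
  (forall p (Y : 'M[R]_(b i.+2, p)), B i.+2 *m Y = 0 -> exists Y', Y = B i.+1 *m Y') ->
  (hom_defect i.+1 j.+1 <= hom_defect i j)%N.
Proof.
move=> extN.
(* [U] holds the lifts to R^(a (j+1)) of cocycles with values in S_j, and [K] the lifts of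
   coboundaries. U/K embeds into Ext^(i+1)(N, S_j) by multiplication with A_j. The connecting map,
   multiplication by B_(i+1), sends U onto Ext^(i+2)(N, S_(j+1)) because Ext^(i+2)(N, R) = 0. *)
pose U : set 'M[R]_(b i.+1, a j.+1) := [set Y | B i.+1 *m Y *m A j = 0].
pose K : set 'M[R]_(b i.+1, a j.+1) :=
  [set Y | U Y /\ hom_coboundaries i j (Y *m A j)].
have hU : submod U.
  split=> [|c X Y]; first by rewrite /U /= mulmx0 mul0mx.
  rewrite /U /= mulmxDr mulmxDl -scalemxAr -scalemxAl => -> ->.
  by rewrite scaler0 addr0.
have hK : submod K.
  apply: submod_setI => //.
  apply: (@submod_preimage _ _ _ (mulmxr (A j))); exact: submod_hom_coboundaries.
have KU : K `<=` U by move=> Y [].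
have hB := submod_hom_coboundaries; have hZ := submod_hom_cocycles.
have BZ := hom_coboundaries_cocycles.
apply: (@leq_trans (len K U)).
  apply: (len_image_le (f := mulmx (B i.+1)) (fV _ _) (fV _ _)) => //.
  - exact: BZ.
  - move=> Y [UY [X /cochainsP [Y1 XE] E]]; rewrite XE /= mulmxA in E.
    have : (Y - B i *m Y1) *m A j = 0 by rewrite mulmxBl E subrr.
    move=> /matrix_exact [Y0 Y0E].
    exists (Y0 *m A j.+1); first by apply/cochainsP; exists Y0.
    by rewrite -Y0E mulmxBr !mulmxA dmx_dmx mul0mx subr0.
  - move=> W [/cochainsP [Y' WE] /extN [Y YE]]; exists Y.
      by rewrite /U /= -YE WE -mulmxA dmx_dmx mulmx0.
    by rewrite YE subrr; exact: (submod_0 (hB _ _)).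
apply: (len_preimage_le (f := mulmxr (A j)) (fV _ _) (fV _ _)) => //; first exact: BZ.
by move=> Y UY; split; [apply/cochainsP; exists Y|rewrite /= mulmxA].
Qed.

Lemma len_cocycles_pair i j :
  (len [set 0%R] (hom_cocycles i j) + len [set 0%R] (hom_cocycles i.+1 j)
   <= b i * len [set 0%R] (syz m FM 0 j) + hom_defect i j)%N.
Proof.
have hB := submod_hom_coboundaries i j; have hZ := submod_hom_cocycles.
have hC := submod_cochains i j.
have sub0 p q (X : set 'M[R]_(p, q)) : submod X -> [set 0] `<=` X.
  by move=> [X0 _] _ ->.
have h0 V := @submod_set0 R V.
have ZC : hom_cocycles i j `<=` cochains i j by move=> X [].
have -> : (b i * len [set 0%R] (syz m FM 0 j))%N = len [set 0%R] (cochains i j).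
  rewrite /cochains -(len_rows_in (b i) fR (h0 _)) //; last exact: sub0.
  congr len; apply/seteqP; split=> [X hX|X -> k]; last by rewrite row0.
  by apply/row_matrixP => k; rewrite row0; apply: hX.
rewrite (len_add (fV _ _) (h0 _) (hZ i j) hC) //; last exact: sub0.
rewrite (len_add (fV _ _) (h0 _) hB (hZ i.+1 j)); [|exact: sub0|exact: hom_coboundaries_cocycles].
rewrite -addnA leq_add2l leq_add2r.
apply: (len_image_le (f := mulmx (B i)) (fV _ _) (fV _ _)) => //; first exact: sub0.
  by move=> X [].
by move=> _ [X hX <-]; exists X => //; rewrite subrr.
Qed.

(** By minimality m^2 S_j lies in m^3 and the differentials for N have entries in m, so the products
    lie in m^4 = 0. *)
Lemma rows_syz_2_cocycles i j : rows_in (syz m FM 2 j) `<=` hom_cocycles i j.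
Proof.
move=> X hX; split; first by move=> k; apply: (syz_le m_max _ (hX k)).
have h4 : entries (mp 4) (B i *m X).
  apply: (@entries_pow_mul _ _ m_max 1 3); first by rewrite pow_1 //; apply: dmx_entries.
  move=> k l; have := syz_entries m_max FM_min (hX k).
  by move=> /(_ 0 l); rewrite mxE.
by apply/matrixP => k l; have := h4 k l; rewrite m4 => ->; rewrite mxE.
Qed.

Lemma len_syz_2 j : len [set 0%R] (syz m FM 2 j) = sigma m FM 2 j.
Proof. by rewrite /sigma (syz_eq0 m_max FM_min (q := 3)). Qed.

Lemma len_rows_syz_2 i j :
  len [set 0%R] (@rows_in _ (b i) _ (syz m FM 2 j)) = (b i * sigma m FM 2 j)%N.
Proof.
rewrite -len_syz_2 -(len_rows_in (b i) fR (@submod_set0 _ _)) //.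
  congr len; apply/seteqP; split=> [X -> k|X hX]; first by rewrite row0.
  by apply/row_matrixP => k; rewrite row0; apply: hX.
by move=> _ ->; case: (hs 2 j).
Qed.

Lemma len_cocycles_ge i j :
  (b i * sigma m FM 2 j <= len [set 0%R] (hom_cocycles i j))%N.
Proof.
have h0 := @submod_set0 R 'M[R]_(b i, a j).
rewrite -len_rows_syz_2; apply: (len_mono (fV _ _) h0 h0) => //.
- by move=> _ -> k; rewrite row0; case: (hs 2 j).
- exact: rows_syz_2_cocycles.
Qed.

(* A filtration from m^2 S_j to m S_j, adding one generator of S_j at a time. *)
Definition syz_filt j t : set 'rV[R]_(a j) :=
  [set v | exists2 x : 'rV[R]_(a j.+1),
     entries m x /\ (forall u : 'I_(a j.+1), (t <= u)%N -> mp 2 (x 0 u)) & v = x *m A j].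
Arguments syz_filt : clear implicits.

Lemma submod_syz_filt j t : submod (syz_filt j t).
Proof.
have hm := submod_m m_max; have h2 := submod_pow m_max 2.
have hE : submod (@entries R 1 (a j.+1) m) by apply: submod_entries.
split.
  exists 0; last by rewrite mul0mx.
  by split=> [|u _]; [case: hE|rewrite mxE; case: h2].
move=> c _ _ [x [mx hx] ->] [y [my hy] ->]; exists (c *: x + y).
  split; first exact: hE.2.
  by move=> u tu; rewrite !mxE; apply: h2.2; [apply: hx|apply: hy].
by rewrite mulmxDl scalemxAl.
Qed.

Lemma syz_filt_S j t : syz_filt j t `<=` syz_filt j t.+1.
Proof. by move=> _ [x [mx hx] ->]; exists x => //; split=> // u /ltnW; apply: hx. Qed.

Lemma syz_filt_0 j : syz_filt j 0 = syz m FM 2 j.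
Proof.
apply/seteqP; split=> _ [x hx ->].
  by exists x => // i u; rewrite [i]ord1; apply: hx.2.
exists x => //; split=> [|u _]; last exact: hx.
by move=> i u; rewrite -(pow_1 m_max); apply: (pow_S m_max).
Qed.

Lemma syz_filt_max j : syz_filt j (a j.+1) = syz m FM 1 j.
Proof.
apply/seteqP; split=> _ [x hx ->]; exists x => //; last rewrite pow_1 // in hx.
  by rewrite pow_1 //; case: hx.
by split=> // u; rewrite leqNgt ltn_ord.
Qed.

(** The annihilator within m of the t-th generator of S_j modulo step t of the filtration. The
    quotient of m by it is the layer between steps t and t + 1. *)
Definition gen_ideal j (t : 'I_(a j.+1)) : set R :=
  [set c | m c /\ syz_filt j t (c *: row t (A j))].

Lemma submod_gen_ideal j t : submod (@gen_ideal j t : set R^o).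
Proof.
apply: submod_setI; first exact: submod_m.
apply: (@submod_preimage _ _ _ (scale_vec (row t (A j))) (syz_filt j t)).
exact: submod_syz_filt.
Qed.

Lemma pow_2_gen_ideal j t : mp 2 `<=` @gen_ideal j t.
Proof.
have h2 := submod_pow m_max 2.
move=> c mc; have mc' : m c by rewrite -(pow_1 m_max); apply: pow_S.
split=> //; exists (c *: delta_mx 0 t); last by rewrite -scalemxAl -rowE.
split=> [i|] u => [|_]; rewrite !mxE.
  by rewrite mulrC; apply: (submod_Z (submod_m m_max)).
by rewrite mulrC; apply: (submod_Z h2).
Qed.

Lemma gen_ideal_m j t : @gen_ideal j t `<=` m.
Proof. by move=> c []. Qed.

Lemma len_syz_filt j (t : 'I_(a j.+1)) :
  (len (syz_filt j t) (syz_filt j t.+1) <= len (gen_ideal t : set R^o) m)%N.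
Proof.
have hm := submod_m m_max; have h2 := submod_pow m_max 2.
apply: (len_image_le (f := scale_vec (row t (A j))) fR (fV _ _)) => //.
- exact: submod_gen_ideal.
- exact: submod_syz_filt.
- exact: submod_syz_filt.
- exact: gen_ideal_m.
- exact: syz_filt_S.
- by move=> c [].
move=> _ [x [mx hx] ->]; exists (x 0 t) => //.
exists (x - x 0 t *: delta_mx 0 t); last first.
  by rewrite mulmxBl -scalemxAl -rowE.
split=> [i|] u => [|tu]; rewrite !mxE.
  rewrite [i]ord1; apply: (submod_B hm) => //; rewrite mulrC; exact: (submod_Z hm).
have [->|ut] := eqVneq u t; first by rewrite !eqxx mulr1 subrr; case: h2.
rewrite andbF mulr0 subr0; apply: hx; rewrite ltn_neqAle tu andbT.
by rewrite eq_sym.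
Qed.

Lemma sigma_1_le j :
  (sigma m FM 1 j <= \sum_(t < a j.+1) len (gen_ideal t : set R^o) m)%N.
Proof.
rewrite /sigma -syz_filt_max -syz_filt_0 (len_telescope _ (fV _ _)).
- by apply: leq_sum => t _; apply: len_syz_filt.
- exact: submod_syz_filt.
- exact: syz_filt_S.
Qed.

(** Intersect the cocycles with the filtration. A column w and the t-th generator g give the
    coboundary B w g, whose rows lie in step t + 1 since B has entries in m. If they lie in step t,
    then B w has entries in [gen_ideal t]. So layer t of the cocycles has at least the length of all
    columns modulo [col_preimage]. *)
Lemma cocycles_gen_ge i j :
  (b i.+1 * sigma m FM 2 j
   + \sum_(t < a j.+1) len (col_preimage FN (gen_ideal t) i) setT
   <= len [set 0%R] (hom_cocycles i.+1 j))%N.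
Proof.
have hZ := submod_hom_cocycles i.+1 j.
pose Q t := hom_cocycles i.+1 j `&` rows_in (syz_filt j t).
have hQ t : submod (Q t).
  by apply: submod_setI => //; apply: submod_rows_in; apply: submod_syz_filt.
have QS t : Q t `<=` Q t.+1.
  by move=> X [ZX hX]; split=> // k; apply: syz_filt_S.
have h0 := @submod_set0 R 'M[R]_(b i.+1, a j).
have hT := @submod_setT R 'M[R]_(b i, 1).
have Q0 : Q 0%N = rows_in (syz m FM 2 j).
  rewrite /Q syz_filt_0; apply/seteqP; split=> [X []//|X hX].
  by split=> //; apply: rows_syz_2_cocycles.
have sub0 t : [set 0] `<=` Q t by move=> _ ->; case: (hQ t).
have Q0a : Q 0%N `<=` Q (a j.+1).
  by elim: (a j.+1) => // t IH X /IH /QS.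
apply: (@leq_trans (len [set 0%R] (Q (a j.+1)))); last first.
  by apply: (len_mono (fV _ _) h0 h0) => // X [].
rewrite (len_add (fV _ _) h0 (hQ 0%N) (hQ (a j.+1))) //.
rewrite Q0 len_rows_syz_2 leq_add2l -Q0 (len_telescope _ (fV _ _)) //.
apply: leq_sum => t _.
have rowE' (w : 'cV[R]_(b i)) k :
    row k (B i *m w *m row t (A j)) = (B i *m w) k 0 *: row t (A j).
  by rewrite row_mul [row k _]mx11_scalar mul_scalar_mx mxE.
have hBw (w : 'cV[R]_(b i)) : entries m (B i *m w).
  by apply: entries_mul; [apply: submod_m|apply: dmx_entries].
apply: (len_preimage_le (f := mulmxr (row t (A j)) \o mulmx (B i)) (fV _ _) (fV _ _)) => //.
- by apply: submod_col_preimage; apply: submod_gen_ideal.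
- move=> w _; split; first split.
  + apply/cochainsP; exists (B i *m w *m delta_mx 0 t).
    by rewrite /= -[in RHS]mulmxA -rowE.
  + by rewrite /= !mulmxA dmx_dmx !mul0mx.
  + move=> k; rewrite [row _ _]rowE'; exists ((B i *m w) k 0 *: delta_mx 0 t).
      split=> [r|] u => [|tu]; rewrite mxE [delta_mx _ _ _ _]mxE.
        by rewrite mulrC; apply: (submod_Z (submod_m m_max)); apply: hBw.
      have -> : (u == t) = false by apply/eqP => ut; rewrite ut ltnn in tu.
      by rewrite andbF mulr0; case: (submod_pow m_max 2).
    by rewrite -scalemxAl -rowE.
- move=> w _ [_ hw] k l; rewrite [l]ord1; split; first exact: hBw.
  by rewrite -rowE'; apply: hw.
Qed.

Variable n : nat.
Hypothesis FN_lin : gr_acyclic_from FN m n.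

Lemma main_inequality e i j : e = len (mp 2 : set R^o) m -> (n <= i.+1)%N ->
  (e * (b i + b i.+1) * sigma m FM 2 j + a j.+1 * b i.+1 + b i * sigma m FM 1 j
   <= e * (b i * len [set 0%R] (syz m FM 0 j) + hom_defect i j)
      + a j.+1 * (e * b i))%N.
Proof.
move=> eE ni; have hm := submod_m m_max; have h2 := submod_pow m_max 2.
pose q (t : 'I_(a j.+1)) := len (col_preimage FN (gen_ideal t) i) setT.
pose c (t : 'I_(a j.+1)) := len (gen_ideal t : set R^o) m.
(* [rank_bound] reads b_(i+1) <= q c + b_i (e - c); then c <= e is used in the product q c only. *)
have qc t : (b i.+1 + b i * c t <= e * q t + e * b i)%N.
  have hI := submod_gen_ideal t.
  have := rank_bound m_max fR FN_min FN_lin hI (@pow_2_gen_ideal _ t)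
    (@gen_ideal_m _ t) ni.
  have -> : e = (len (mp 2 : set R^o) (gen_ideal t) + c t)%N.
    rewrite eE; apply: (@len_add _ R^o fR) => //; first exact: pow_2_gen_ideal.
    exact: gen_ideal_m.
  rewrite -/(q t) -/(c t); nia.
have sum_qc : (a j.+1 * b i.+1 + b i * (\sum_t c t)
    <= e * (\sum_t q t) + a j.+1 * (e * b i))%N.
  have : (\sum_t (b i.+1 + b i * c t) <= \sum_t (e * q t + e * b i))%N.
    exact: leq_sum.
  by rewrite !big_split /= !sum_nat_const card_ord -!big_distrr.
have s1 : (sigma m FM 1 j <= \sum_t c t)%N := sigma_1_le j.
have z1 := len_cocycles_ge i j.
have z2 : (b i.+1 * sigma m FM 2 j + \sum_t q t
   <= len [set 0%R] (hom_cocycles i.+1 j))%N := cocycles_gen_ge i j.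
have z3 := len_cocycles_pair i j.
have s1' : (b i * sigma m FM 1 j <= b i * \sum_t c t)%N by rewrite leq_mul2l s1 orbT.
have z4 : (e * (b i * sigma m FM 2 j + (b i.+1 * sigma m FM 2 j + \sum_t q t))
   <= e * (b i * len [set 0%R] (syz m FM 0 j) + hom_defect i j))%N.
  by rewrite leq_mul2l (leq_trans (leq_add z1 z2) z3) orbT.
move: z4; rewrite !mulnDr !mulnDl -!mulnA; lia.
Qed.

End TwoResolutions.

(** * Independence of the resolution *)

Section Comparison.
Context {R : comNzRingType} {M : lmodType R}.

Definition res_ker (F : free_resolution M) i : set 'rV[R]_(rk F i) :=
  match i with
  | 0 => [set x | aug F x = 0]
  | i'.+1 => [set x | x *m dmx F i' = 0]
  end.
Arguments res_ker : clear implicits.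

Lemma res_kerP F i x : res_ker F i x <-> exists w, x = w *m dmx F i.
Proof. by case: i x => [|i] x; [apply: exact_aug|apply: exact_diff]. Qed.

Lemma chain_map_ex (F G : free_resolution M) :
  exists f : forall i, 'M[R]_(rk F i, rk G i),
    (forall x, aug G (x *m f 0%N) = aug F x) /\
    (forall i, f i.+1 *m dmx G i = dmx F i *m f i).
Proof.
pose good i (f : 'M[R]_(rk F i, rk G i)) :=
  forall x, res_ker F i x -> res_ker G i (x *m f).
have [f0 hf0] : exists f0 : 'M[R]_(rk F 0, rk G 0), forall x, aug G (x *m f0) = aug F x.
  have /choice [w hw] : forall k : 'I_(rk F 0), exists w, aug G w = aug F (delta_mx 0 k).
    by move=> k; apply: aug_surj.
  exists (\matrix_k w k) => x; rewrite {2}(row_sum_delta x) mulmx_sum_row !linear_sum.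
  by apply: eq_bigr => k _; rewrite !linearZ rowK hw.
have good0 : good 0%N f0 by move=> x /= x0; rewrite hf0.
have step i (f : 'M[R]_(rk F i, rk G i)) : good i f ->
    exists f', good i.+1 f' /\ f' *m dmx G i = dmx F i *m f.
  move=> gf; have [|f' f'E] := @mx_rows_ex _ _ _ _ (dmx F i *m f) (dmx G i).
    move=> k; apply/res_kerP; rewrite row_mul; apply: gf; apply/res_kerP.
    by exists (delta_mx 0 k); rewrite -rowE.
  exists f'; split=> // x /= xF.
  by rewrite -mulmxA -f'E mulmxA xF mul0mx.
(* A lift to the next degree is available only for a map that preserves kernels, so the recursion
   carries this property. *)
pose next i (f : {f | good i f}) : {f' | good i.+1 f'} :=
  exist _ (projT1 (cid (step i _ (proj2_sig f)))) (projT2 (cid (step i _ (proj2_sig f)))).1.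
pose fs := nat_rect (fun i => {f | good i f}) (exist _ f0 good0) next.
exists (fun i => proj1_sig (fs i)); split=> // i.
exact: (projT2 (cid (step i _ (proj2_sig (fs i))))).2.
Qed.

(** No sequence of homotopies has to be chosen: the induction only asserts some h for which d_i - h
    A_i is killed by A_i on the left. Exactness then yields h', which serves as the h of the next
    degree. *)
Lemma null_homotopy (F : free_resolution M) (d : forall i, 'M[R]_(rk F i)) :
  (forall x, aug F (x *m d 0%N) = 0) ->
  (forall i, d i.+1 *m dmx F i = dmx F i *m d i) ->
  forall i, exists h h', d i.+1 = h' *m dmx F i.+1 + dmx F i *m h.
Proof.
move=> d0 dS i.
suff [h hE] : exists h, dmx F i *m (d i - h *m dmx F i) = 0.
  have /matrix_exact [h' h'E] : (d i.+1 - dmx F i *m h) *m dmx F i = 0.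
    by rewrite mulmxBl dS -mulmxA -mulmxBr.
  by exists h, h'; rewrite -h'E subrK.
elim: i => [|i [h hE]].
  have [|h hE] := @mx_rows_ex _ _ _ _ (d 0%N) (dmx F 0).
    by move=> k; apply/exact_aug; rewrite rowE d0.
  by exists h; rewrite hE subrr mulmx0.
have /matrix_exact [h' h'E] : (d i.+1 - dmx F i *m h) *m dmx F i = 0.
  by rewrite mulmxBl dS -mulmxA -mulmxBr.
exists h'; rewrite -h'E opprB addrC subrK.
by rewrite mulmxA dmx_dmx mul0mx.
Qed.

Lemma homotopy_equivalence (F G : free_resolution M) :
  exists (f : forall i, 'M[R]_(rk F i, rk G i)) (g : forall i, 'M[R]_(rk G i, rk F i)),
  [/\ forall i, f i.+1 *m dmx G i = dmx F i *m f i,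
      forall i, g i.+1 *m dmx F i = dmx G i *m g i &
      forall i, exists h h',
        f i.+1 *m g i.+1 = 1%:M + (h' *m dmx F i.+1 + dmx F i *m h)].
Proof.
have [f [f0 fS]] := chain_map_ex F G; have [g [g0 gS]] := chain_map_ex G F.
exists f, g; split=> // i.
have [] := @null_homotopy F (fun i => f i *m g i - 1%:M) _ _ i.
- by move=> x; rewrite mulmxBr mulmx1 mulmxA linearB /= g0 f0 subrr.
- by move=> k; rewrite mulmxBl mulmxBr mul1mx mulmx1 -mulmxA gS mulmxA fS mulmxA.
by move=> h [h' hE]; exists h, h'; rewrite -hE addrC subrK.
Qed.

(** [Ext_zero] concerns functionals on some resolution G. Here it is carried to the given F and to
    matrices, each column being a functional. *)
Lemma Ext_zero_mx (F : free_resolution M) i p (Y : 'M[R]_(rk F i.+1, p)) :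
  Ext_zero M i.+1 -> dmx F i.+1 *m Y = 0 -> exists Y', Y = dmx F i *m Y'.
Proof.
move=> [G hG] FY; have [f [g [fS gS hfg]]] := homotopy_equivalence F G.
have [Y1 Y1E] : exists Y1, g i.+1 *m Y = dmx G i *m Y1.
  have /choice [c hc] : forall k, exists c, col k (g i.+1 *m Y) = dmx G i *m c.
    move=> k; set y := col k _.
    have yG : dmx G i.+1 *m y = 0.
      by rewrite /y !colE !mulmxA -gS -(mulmxA (g i.+2)) FY mulmx0 mul0mx.
    pose phi (x : 'rV[R]_(rk G i.+1)) : R^o := (x *m y) 0 0.
    have phi_lin : linear phi by move=> a u v; rewrite /phi mulmxDl -scalemxAl !mxE.
    pose Phi : {linear 'rV[R]_(rk G i.+1) -> R^o} :=
      HB.pack phi (GRing.isLinear.Build R _ _ _ phi phi_lin).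
    have [psi psiE] : coboundary G i.+1 Phi.
      by apply: hG => x; rewrite /= /phi -mulmxA yG mulmx0 mxE.
    exists (\col_l psi (delta_mx 0 l)); apply/colP => l.
    transitivity (Phi (delta_mx 0 l)); first by rewrite /= /phi -rowE [RHS]mxE.
    rewrite psiE -rowE [in LHS](row_sum_delta (row l _)) linear_sum [RHS]mxE.
    by apply: eq_bigr => u _; rewrite linearZ /= !mxE.
  exists (\matrix_(l, k) c k l 0); apply/matrixP => l k.
  have /colP /(_ l) := hc k; rewrite !mxE => ->.
  by apply: eq_bigr => u _; rewrite mxE.
have [h [h' hE]] := hfg i.
(* The homotopy f g = 1 + h' A_(i+1) + A_i h is applied to Y; the h' term dies on the cocycle Y, and
   f g Y = A_i f Y1. *)
exists (f i *m Y1 - h *m Y).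
rewrite mulmxBr !mulmxA -fS -[f i.+1 *m _ *m Y1]mulmxA -Y1E mulmxA hE.
by rewrite !mulmxDl mul1mx -(mulmxA h') FY mulmx0 add0r addrK.
Qed.

End Comparison.

(** * Betti numbers as ranks of the minimal resolution *)

Section TorRank.
Context {R : comNzRingType} (m : set R).
Hypotheses (m_max : maximal_ideal m) (fR : finite_length R^o).
Context {M : lmodType R}.

Let fV p q : finite_length 'M[R]_(p, q) := finite_length_mx p q fR.

Definition tor_cycles (F : free_resolution M) i : set 'rV[R]_(rk F i.+1) :=
  [set x | entries m (x *m dmx F i)].
Arguments tor_cycles : clear implicits.
Definition tor_boundaries (F : free_resolution M) i : set 'rV[R]_(rk F i.+1) :=
  [set x | exists y z, entries m z /\ x = y *m dmx F i.+1 + z].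
Arguments tor_boundaries : clear implicits.

Lemma submod_tor_cycles F i : submod (tor_cycles F i).
Proof.
apply: (@submod_preimage _ _ _ (mulmxr (dmx F i)) (entries m)).
by apply: submod_entries; apply: submod_m.
Qed.

Lemma submod_tor_boundaries F i : submod (tor_boundaries F i).
Proof.
have hE : submod (@entries R 1 (rk F i.+1) m).
  by apply: submod_entries; apply: submod_m.
split; first by exists 0, 0; rewrite mul0mx addr0; split=> //; case: hE.
move=> a _ _ [x [y [my ->]]] [z [w [mw ->]]]; exists (a *: x + z), (a *: y + w).
split; first exact: hE.2.
by rewrite scalerDr scalemxAl addrACA -mulmxDl.
Qed.

Lemma tor_boundaries_cycles F i : tor_boundaries F i `<=` tor_cycles F i.
Proof.
move=> _ [y [z [mz ->]]]; rewrite /tor_cycles /= mulmxDl -mulmxA dmx_dmx mulmx0 add0r.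
by apply: entries_mul => //; apply: submod_m.
Qed.

(** A homotopy equivalence is injective on Tor; exchanging F and G gives the opposite inequality. *)
Lemma len_tor_le F G i :
  (len (tor_boundaries F i) (tor_cycles F i) <=
   len (tor_boundaries G i) (tor_cycles G i))%N.
Proof.
have [f [g [fS gS hfg]]] := homotopy_equivalence F G.
have hm := submod_m m_max.
apply: (len_preimage_le (f := mulmxr (f i.+1)) (fV _ _) (fV _ _)).
- exact: submod_tor_boundaries.
- exact: submod_tor_cycles.
- exact: submod_tor_boundaries.
- exact: submod_tor_cycles.
- exact: tor_boundaries_cycles.
- exact: tor_boundaries_cycles.
- move=> x hx; rewrite /tor_cycles /= -mulmxA fS mulmxA.
  exact: entries_mul.
move=> x hx [y [z [mz /= xfE]]]; have [h [h' hE]] := hfg i.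
exists (y *m g i.+2 - x *m h'), (z *m g i.+1 - x *m dmx F i *m h); split.
  by apply: (submod_B (submod_entries _ _ hm)); apply: entries_mul.
have : x *m f i.+1 *m g i.+1 = y *m g i.+2 *m dmx F i.+1 + z *m g i.+1.
  by rewrite xfE mulmxDl -!mulmxA gS.
rewrite -mulmxA hE !mulmxDr mulmx1 !mulmxA => E.
by rewrite mulmxBl addrACA -E -opprD addrK.
Qed.

Lemma len_tor_minimal F i : minimal F m ->
  len (tor_boundaries F i) (tor_cycles F i) = rk F i.+1.
Proof.
move=> F_min; have hm := submod_m m_max.
have -> : tor_cycles F i = entries setT.
  apply/seteqP; split=> // x _ k l.
  have := entries_dmx m_max F_min (q := 0) (X := x).
  by rewrite pow_1 //; apply.
have -> : tor_boundaries F i = entries m.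
  apply/seteqP; split=> [_ [y [z [mz ->]]]|x mx]; last first.
    by exists 0, x; rewrite mul0mx add0r.
  apply: (submod_D (submod_entries _ _ hm)) => //.
  have := entries_dmx m_max F_min (q := 0) (X := y).
  by rewrite pow_1 //; apply.
rewrite (len_entries _ _ fR hm (@submod_setT _ R^o)) //.
by rewrite (len_m_ring m_max fR) muln1 mul1n.
Qed.

(** [is_betti_sequence] may use another resolution in each degree, so each of them is compared with
    the minimal one. *)
Lemma betti_rank (F : free_resolution M) (bM : nat -> nat) i : minimal F m ->
  is_betti_sequence m M bM -> bM i.+1 = rk F i.+1.
Proof.
move=> F_min /(_ i.+1) [G hdim].
rewrite -(len_tor_minimal i F_min).
have cE : cycles (fun i => setT : set 'rV[R]_(rk G i))
    (fun i => ideal_smul m setT : set 'rV[R]_(rk G i)) i.+1 = tor_cycles G i.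
  rewrite /tor_cycles -(smul_entries _ (submod_m m_max)).
  by apply/seteqP; split=> x //= [].
have bE : boundaries (fun i => setT : set 'rV[R]_(rk G i))
    (fun i => ideal_smul m setT : set 'rV[R]_(rk G i)) i.+1 = tor_boundaries G i.
  rewrite /tor_boundaries -(smul_entries _ (submod_m m_max)).
  apply/seteqP; split=> x [y [z]]; first by move=> [_ mz ->]; exists y, z.
  by move=> [mz ->]; exists y, z.
suff <- : len (tor_boundaries G i) (tor_cycles G i) = bM i.+1.
  by apply/eqP; rewrite eqn_leq !len_tor_le.
apply: (has_kdim_len m_max (fV _ _)); last by rewrite -cE -bE.
- exact: submod_tor_boundaries.
- exact: submod_tor_cycles.
- exact: tor_boundaries_cycles.
move=> a x ma _; exists 0, (a *: x); rewrite mul0mx add0r; split=> // k l.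
by rewrite mxE mulrC; apply: (submod_Z (submod_m m_max)).
Qed.

End TorRank.

(** * Growth of the Betti sequences *)

Section Growth.
Context {K : realType}.
Implicit Types (u : nat -> nat) (w lam : nat -> K).

(** The model [w] will be i^n or a^i. Dividing the estimate by [w] squeezes u/w to alpha, which is
    nonzero, so [u] inherits the limit of consecutive ratios of [w]. *)
Lemma asymp_ratio u w lam (alpha x : K) : 0 < alpha ->
  (\forall i \near \oo, 0 < w i) ->
  (fun i => w i.+1 / w i) @ \oo --> x ->
  (fun i => lam i / w i) @ \oo --> (0 : K) ->
  (\forall i \near \oo, alpha * w i - lam i <= (u i)%:R <= alpha * w i + lam i) ->
  [/\ \forall i \near \oo, (0 < u i)%N,
      (fun i => (u i)%:R / w i) @ \oo --> alpha &
      (fun i => (u i.+1)%:R / (u i)%:R : K) @ \oo --> x].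
Proof.
move=> alpha0 w0 wx lam0 hu.
have uw : (fun i => (u i)%:R / w i) @ \oo --> alpha.
  have lo : (fun i => alpha - lam i / w i) @ \oo --> alpha.
    by rewrite -[X in _ --> X]subr0; apply: cvgB lam0; apply: cvg_cst.
  have hi : (fun i => alpha + lam i / w i) @ \oo --> alpha.
    by rewrite -[X in _ --> X]addr0; apply: cvgD lam0; apply: cvg_cst.
  apply: squeeze_cvgr lo hi; near=> i.
  have wi : 0 < w i by near: i.
  have /andP [h1 h2] : alpha * w i - lam i <= (u i)%:R <= alpha * w i + lam i.
    by near: i.
  by rewrite ler_pdivlMr // ler_pdivrMr // mulrBl mulrDl divfK ?gt_eqF // h1.
have upos : \forall i \near \oo, (0 < u i)%N.
  have hpos : \forall i \near \oo, 0 < (u i)%:R / w i.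
    exact: (@cvgr_gt _ _ _ _ _ _ uw _ alpha0).
  near=> i; have wi : 0 < w i by near: i.
  have : 0 < (u i)%:R / w i by near: i.
  by rewrite pmulr_lgt0 ?invr_gt0 // ltr0n.
split=> //.
have uwS : (fun i => (u i.+1)%:R / w i.+1) @ \oo --> alpha.
  by have := uw; rewrite -(cvg_shiftS (fun i => (u i)%:R / w i)).
have wS : \forall i \near \oo, 0 < w i.+1.
  have [N _ hN] := w0; exists N => // i /= Ni; apply: hN => /=; exact: leqW.
have lim : (fun i => ((u i.+1)%:R / w i.+1) * (w i.+1 / w i) * ((u i)%:R / w i)^-1)
    @ \oo --> alpha * x * alpha^-1.
  by apply: cvgM; [apply: cvgM|apply: cvgV => //; rewrite gt_eqF].
have -> : x = alpha * x * alpha^-1 by rewrite mulrAC divff ?mul1r // gt_eqF.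
apply: cvg_trans lim; apply: near_eq_cvg; near=> i.
have wi : w i != 0 by rewrite gt_eqF //; near: i.
have wi' : w i.+1 != 0 by rewrite gt_eqF //; near: i.
have ui : (u i)%:R != 0 :> K by rewrite pnatr_eq0 -lt0n; near: i.
by field; rewrite wi wi' ui.
Unshelve. all: by end_near. Qed.

Lemma polynomial_growth_ratio u : polynomial_growth K u ->
  (\forall i \near \oo, (0 < u i)%N) /\
  (fun i => (u i.+1)%:R / (u i)%:R : K) @ \oo --> (1 : K).
Proof.
move=> [n [alpha [lam [alpha0 lam0 hu]]]].
have w0 : \forall i \near \oo, 0 < (i%:R ^+ n : K).
  by exists 1%N => // i /= i1; rewrite exprn_gt0 // ltr0n.
have base : (fun i => i.+1%:R / i%:R : K) @ \oo --> (1 : K).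
  have h : (fun i => 1 + (i%:R)^-1 : K) @ \oo --> (1 : K).
    rewrite -[X in _ --> X]addr0; apply: cvgD; first exact: cvg_cst.
    have n0 : \forall i \near \oo, 0 < (i%:R : K) by exists 1%N => // i /=; rewrite ltr0n.
    exact: ((@gtr0_cvgV0 _ _ _ _ _ n0).2 (@cvgr_idn K)).
  apply: cvg_trans h; apply: near_eq_cvg; exists 1%N => // i /= i1.
  by rewrite -natr1 mulrDl divff ?mul1r // pnatr_eq0 -lt0n.
have wx : (fun i => i.+1%:R ^+ n / i%:R ^+ n : K) @ \oo --> (1 : K).
  have -> : (fun i => i.+1%:R ^+ n / i%:R ^+ n : K) = (fun i => (i.+1%:R / i%:R) ^+ n).
    by apply/funext => i; rewrite expr_div_n.
  rewrite -[X in _ --> X](expr1n _ n).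
  apply: (@continuous_cvg _ _ _ _ _ (fun i => i.+1%:R / i%:R : K) (fun y => y ^+ n)) => //.
  exact: exprn_continuous.
by have [] := asymp_ratio alpha0 w0 wx lam0 hu.
Qed.

Lemma exponential_growth_ratio u : exponential_growth K u ->
  exists x : K, [/\ 1 < x, \forall i \near \oo, (0 < u i)%N,
    (fun i => (u i.+1)%:R / (u i)%:R : K) @ \oo --> x &
    (fun i => (u i)%:R^-1 : K) @ \oo --> (0 : K)].
Proof.
move=> [x [alpha [lam [x1 alpha0 lam0 hu]]]]; exists x.
have x0 : 0 < x by apply: lt_trans x1.
have w0 : \forall i \near \oo, 0 < x ^+ i by near=> i; rewrite exprn_gt0.
have wx : (fun i => x ^+ i.+1 / x ^+ i) @ \oo --> x.
  have -> : (fun i => x ^+ i.+1 / x ^+ i) = (fun=> x).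
    by apply/funext => i; rewrite exprS mulfK // expf_neq0 // gt_eqF.
  exact: cvg_cst.
have [upos uw ux] := asymp_ratio alpha0 w0 wx lam0 hu; split=> //.
have geo : (fun i => x^-1 ^+ i) @ \oo --> (0 : K).
  apply: cvg_expr; rewrite ger0_norm ?invr_ge0 ?(ltW x0) //.
  by rewrite invf_lt1.
have lim : (fun i => ((u i)%:R / x ^+ i)^-1 * x^-1 ^+ i) @ \oo --> alpha^-1 * 0.
  by apply: cvgM => //; apply: cvgV => //; rewrite gt_eqF.
rewrite mulr0 in lim; apply: cvg_trans lim; apply: near_eq_cvg; near=> i.
have ui : (u i)%:R != 0 :> K by rewrite pnatr_eq0 -lt0n; near: i.
by rewrite exprVn; field; rewrite ui expf_neq0 // gt_eqF.
Unshelve. all: by end_near. Qed.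

Lemma ratio_shift u (x : K) k :
  (\forall i \near \oo, (0 < u i)%N) ->
  (fun i => (u i.+1)%:R / (u i)%:R : K) @ \oo --> x ->
  (fun i => (u (i + k)%N)%:R / (u i)%:R : K) @ \oo --> x ^+ k.
Proof.
move=> upos ux; elim: k => [|k IH].
  rewrite expr0; have h : (fun=> 1 : K) @ \oo --> (1 : K) by exact: cvg_cst.
  apply: cvg_trans h; apply: near_eq_cvg; near=> i.
  by rewrite addn0 divff // pnatr_eq0 -lt0n; near: i.
have uxk : (fun i => (u (i + k).+1)%:R / (u (i + k)%N)%:R : K) @ \oo --> x.
  by have := ux; rewrite -(cvg_shiftn k (fun i => (u i.+1)%:R / (u i)%:R : K)).
have uposk : \forall i \near \oo, (0 < u (i + k)%N)%N.
  by have [N _ hN] := upos; exists N => // i /= Ni; apply: hN => /=; lia.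
have lim : (fun i => (u (i + k).+1)%:R / (u (i + k)%N)%:R * ((u (i + k)%N)%:R / (u i)%:R) : K)
    @ \oo --> x ^+ k.+1 by rewrite exprS; apply: cvgM.
apply: cvg_trans lim; apply: near_eq_cvg; near=> i.
rewrite addnS mulrA divfK // pnatr_eq0 -lt0n; near: i; exact: uposk.
Unshelve. all: by end_near. Qed.

(** After division by u_i, a shift by k becomes x^k in the limit. *)
Lemma char_root u (x : K) (e r s : nat) :
  (\forall i \near \oo, (0 < u i)%N) ->
  (fun i => (u i.+1)%:R / (u i)%:R : K) @ \oo --> x ->
  (\forall i \near \oo, (u (i + 3) + r * u (i + 1) = e * u (i + 2) + s * u i)%N) ->
  x ^+ 3 + r%:R * x = e%:R * x ^+ 2 + s%:R.
Proof.
move=> upos ux urec.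
have h k := @ratio_shift u x k upos ux.
have l1 : (fun i => (u (i + 3)%N)%:R / (u i)%:R + r%:R * ((u (i + 1)%N)%:R / (u i)%:R) : K)
    @ \oo --> x ^+ 3 + r%:R * x ^+ 1.
  by apply: cvgD => //; apply: cvgM => //; apply: cvg_cst.
have l2 : (fun i => e%:R * ((u (i + 2)%N)%:R / (u i)%:R) + s%:R : K)
    @ \oo --> e%:R * x ^+ 2 + s%:R.
  by apply: cvgD; [apply: cvgM => //; apply: cvg_cst|apply: cvg_cst].
rewrite expr1 in l1.
have l3 : (fun i => (u (i + 3)%N)%:R / (u i)%:R + r%:R * ((u (i + 1)%N)%:R / (u i)%:R) : K)
    @ \oo --> e%:R * x ^+ 2 + s%:R.
  apply: cvg_trans l2; apply: near_eq_cvg; near=> i.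
  have ui : (u i)%:R != 0 :> K by rewrite pnatr_eq0 -lt0n; near: i.
  have E : (u (i + 3) + r * u (i + 1) = e * u (i + 2) + s * u i)%N by near: i.
  have /(congr1 (fun n => n%:R : K)) := E; rewrite !natrD !natrM => E'.
  by rewrite !mulrA -mulrDl E' mulrDl mulfK.
exact: (cvg_unique _ l1 l3).
Unshelve. all: by end_near. Qed.

(* [x] and [s / x] are the roots of T^2 - (e - 1) T + s, and for s >= 2 the
   inequality forces s < e - 1 < s + 1. *)
Lemma hilbert_coef_eq1 (x : K) (e r s : nat) : (0 < s)%N -> 1 < x ->
  (1 : K) + r%:R = e%:R + s%:R ->
  x ^+ 3 + r%:R * x = e%:R * x ^+ 2 + s%:R ->
  e%:R * x * s%:R + x - 1 <= e%:R * e%:R ->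
  s = 1%N /\ r = e.
Proof.
move=> s0 x1 re xroot ineq.
have re' : (1 + r = e + s)%N.
  by apply/eqP; rewrite -(eqr_nat K) !natrD; apply/eqP.
suff s1 : s = 1%N by split=> //; lia.
(* By [re] the cubic also has the root 1, and x - 1 is nonzero. *)
have root2 : x ^+ 2 + s%:R = (e%:R - 1) * x.
  have rE : r%:R = e%:R + s%:R - 1 :> K by rewrite -re addrC addKr.
  have : (x - 1) * (x ^+ 2 + s%:R - (e%:R - 1) * x) = 0.
    by move: xroot; rewrite rE => /eqP; rewrite -subr_eq0 => /eqP <-; ring.
  by move=> /eqP; rewrite mulf_eq0 !subr_eq0 gt_eqF //= => /eqP.
have e_ge0 : 0 <= e%:R :> K by rewrite ler0n.
have xs : x * s%:R < e%:R.
  rewrite ltNge; apply/negP => he.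
  have : e%:R * e%:R <= e%:R * (x * s%:R) by rewrite ler_wpM2l.
  by rewrite mulrA => h; lra.
apply: contrapT => /eqP s1.
have s2 : (2 <= s)%N by lia.
have s2' : (2 : K) <= s%:R by rewrite ler_nat.
have sx : s%:R * (x - 1) < x.
  (* x times [xs], with [root2] substituted *)
  have h : x * (x * s%:R) < x * e%:R by rewrite ltr_pM2l //; lra.
  have : (x + 1) * (s%:R * (x - 1)) < (x + 1) * x by lra.
  by rewrite ltr_pM2l //; lra.
(* Here x (e - 1) = x^2 + s, and s (x - 1) < x < x^2. *)
have lo : s%:R < e%:R - 1 :> K.
  have : x * s%:R < x * (e%:R - 1) by nra.
  by rewrite ltr_pM2l //; lra.
(* From [sx], x < s / (s - 1) <= 2 <= s. *)
have xles : x < s%:R by nra.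
(* The inequality x^2 + s < x (s + 1) says (x - 1) (x - s) < 0. *)
have hi : e%:R - 1 < s%:R + 1 :> K.
  have : x * (e%:R - 1) < x * (s%:R + 1) by nra.
  by rewrite ltr_pM2l //; lra.
have : (s.+1 < e)%N by rewrite -(ltr_nat K) -natr1; lra.
have : (e < s.+2)%N by rewrite -(ltr_nat K) -!natr1; lra.
lia.
Qed.

End Growth.

(** * The main inequality in the limit *)

Section Limit.
Context {K : realType}.

(** Here [u] and [v] are the Betti sequences of M and N, [s1] and [s2] the lengths of mS_i/m^2S_i
    and m^2S_i, and [E] a bound for the Ext lengths on the diagonal. The inequality is divided by
    u_(i+1) v_i; the limit of s2_i/u_(i+1) is r - e + 1. *)
Lemma limit_inequality (u v : nat -> nat) (x : K) (e r E : nat) (s1 s2 : nat -> nat) :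
  (\forall i \near \oo, (0 < u i)%N) -> (\forall i \near \oo, (0 < v i)%N) ->
  (fun i => (u i.+1)%:R / (u i)%:R : K) @ \oo --> (1 : K) ->
  (fun i => (v i.+1)%:R / (v i)%:R : K) @ \oo --> x ->
  (fun i => (v i)%:R^-1 : K) @ \oo --> (0 : K) ->
  (\forall i \near \oo, (s1 i + u (i + 2) = e * u (i + 1))%N) ->
  (\forall i \near \oo, (s2 i + e * u (i + 2) = r * u (i + 1) + u (i + 3))%N) ->
  (\forall i \near \oo,
     (e * (v i + v i.+1) * s2 i + u (i + 1) * v i.+1 + v i * s1 i
      <= e * (v i * (u (i + 1) + s1 i + s2 i) + E) + u (i + 1) * (e * v i))%N) ->
  e%:R * x * (r%:R - e%:R + 1) + x - 1 <= e%:R * e%:R :> K.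
Proof.
move=> upos vpos ux vx v0 hs1 hs2 ineq.
have uposS : \forall i \near \oo, (0 < u (i + 1)%N)%N.
  by have [N _ hN] := upos; exists N => // i /= Ni; apply: hN => /=; lia.
have uS k : (fun i => (u (i + 1 + k)%N)%:R / (u (i + 1)%N)%:R : K) @ \oo --> (1 : K).
  rewrite -[X in _ --> X](expr1n _ k).
  have := ratio_shift (k := k) upos ux.
  by rewrite -(cvg_shiftn 1 (fun i => (u (i + k)%N)%:R / (u i)%:R : K)).
have c (y : K) : (fun=> y) @ \oo --> y by apply: cvg_cst.
pose p1 i : K := (u (i + 1 + 1)%N)%:R / (u (i + 1)%N)%:R.
pose p2 i : K := (u (i + 1 + 2)%N)%:R / (u (i + 1)%N)%:R.
pose w i : K := (v i.+1)%:R / (v i)%:R.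
pose z i : K := (v i)%:R^-1.
have S2 : (fun i => r%:R - e%:R * p1 i + p2 i) @ \oo --> (r%:R - e%:R * 1 + 1 : K).
  by apply: cvgD (uS 2); apply: cvgB => //; apply: cvgM => //; apply: (uS 1).
have S1 : (fun i => e%:R - p1 i) @ \oo --> (e%:R - 1 : K).
  by apply: cvgB => //; apply: (uS 1).
have lhs : (fun i => e%:R * (1 + w i) * (r%:R - e%:R * p1 i + p2 i) + w i + (e%:R - p1 i))
    @ \oo --> (e%:R * (1 + x) * (r%:R - e%:R * 1 + 1) + x + (e%:R - 1) : K).
  apply: cvgD S1; apply: cvgD => //; apply: cvgM S2; apply: cvgM => //.
  exact: cvgD.
have rhs : (fun i => e%:R * (1 + (e%:R - p1 i) + (r%:R - e%:R * p1 i + p2 i) + E%:R * z i) + e%:R)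
    @ \oo --> (e%:R * (1 + (e%:R - 1) + (r%:R - e%:R * 1 + 1) + E%:R * 0) + e%:R : K).
  apply: cvgD => //; apply: cvgM => //; apply: cvgD; last by apply: cvgM.
  by apply: cvgD S2; apply: cvgD.
suff : e%:R * (1 + x) * (r%:R - e%:R * 1 + 1) + x + (e%:R - 1)
   <= e%:R * (1 + (e%:R - 1) + (r%:R - e%:R * 1 + 1) + E%:R * 0) + e%:R :> K by lra.
apply: (ler_cvg_to lhs rhs); near=> i.
have Upos : (0 < u (i + 1)%N)%N by near: i.
have Vpos : (0 < v i)%N by near: i.
have h1 : (s1 i + u (i + 2) = e * u (i + 1))%N by near: i.
have h2 : (s2 i + e * u (i + 2) = r * u (i + 1) + u (i + 3))%N by near: i.
have h3 : (e * (v i + v i.+1) * s2 i + u (i + 1) * v i.+1 + v i * s1 i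
  <= e * (v i * (u (i + 1) + s1 i + s2 i) + E) + u (i + 1) * (e * v i))%N by near: i.
have U1 : (1 : K) <= (u (i + 1)%N)%:R by rewrite ler1n.
have V0 : (0 : K) < (v i)%:R by rewrite ltr0n.
have U2E : (u (i + 2)%N)%:R = p1 i * (u (i + 1)%N)%:R.
  by rewrite /p1 -addnA divfK // pnatr_eq0 -lt0n.
have U3E : (u (i + 3)%N)%:R = p2 i * (u (i + 1)%N)%:R.
  by rewrite /p2 -addnA divfK // pnatr_eq0 -lt0n.
have VE : (v i.+1)%:R = w i * (v i)%:R by rewrite /w divfK // gt_eqF.
have zE : z i * (v i)%:R = 1 by rewrite /z mulVf // gt_eqF.
have s1E : (s1 i)%:R = (e%:R - p1 i) * (u (i + 1)%N)%:R.
  have /(congr1 (fun n => n%:R : K)) := h1.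
  by rewrite natrD natrM U2E => /eqP; rewrite -subr_eq0 => /eqP H; apply/eqP;
    rewrite -subr_eq0; apply/eqP; rewrite -H; ring.
have s2E : (s2 i)%:R = (r%:R - e%:R * p1 i + p2 i) * (u (i + 1)%N)%:R.
  have /(congr1 (fun n => n%:R : K)) := h2.
  by rewrite !natrD !natrM U2E U3E => /eqP; rewrite -subr_eq0 => /eqP H; apply/eqP;
    rewrite -subr_eq0; apply/eqP; rewrite -H; ring.
move: h3; rewrite -(ler_nat K) !(natrD, natrM) s1E s2E VE.
move: (p1 i) (p2 i) (w i) (z i) zE U1 V0 {h1 h2 U2E U3E VE s1E s2E}.
move: (u (i + 1)%N)%:R (v i)%:R => U V p q y t tV U1 V0 h3.
have UV : 0 < U * V by rewrite mulr_gt0 //; apply: lt_le_trans U1.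
(* As U >= 1, the constant E may be replaced by E U, which becomes E/V after the division and tends
   to 0. *)
have EU : E%:R <= E%:R * U by rewrite ler_peMr.
rewrite -(ler_pM2r UV).
have -> : (e%:R * (1 + (e%:R - p) + (r%:R - e%:R * p + q) + E%:R * t) + e%:R) * (U * V)
  = e%:R * (1 + (e%:R - p) + (r%:R - e%:R * p + q)) * (U * V)
    + e%:R * (E%:R * U) * (t * V) + e%:R * (U * V) by ring.
rewrite tV mulr1.
have : e%:R * E%:R <= e%:R * (E%:R * U) by rewrite ler_wpM2l.
move: h3; lra.
Unshelve. all: by end_near. Qed.

End Limit.

(** * The Hilbert polynomial *)

Section HilbertCoefficients.
Context {R : comNzRingType} (m : set R).
Hypotheses (m_max : maximal_ideal m) (fR : finite_length R^o).
Local Notation mp := (ideal_pow m).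
Hypothesis m4 : mp 4 = [set 0].

Definition hilb q := len (mp q.+1 : set R^o) (mp q).

Lemma hilb_kdim q : @has_kdim R m R^o (mp q) (mp q.+1) (hilb q).
Proof.
apply: (len_has_kdim m_max fR); try exact: submod_pow.
- exact: pow_S.
- by move=> a x; apply: pow_mulm.
Qed.

Lemma hilb_0 : hilb 0 = 1%N.
Proof. by rewrite /hilb pow_1 //; apply: len_m_ring. Qed.

Lemma hilb_ge4 q : (4 <= q)%N -> hilb q = 0%N.
Proof.
move=> q4; rewrite /hilb (pow_ge4 m_max m4 q4) (pow_ge4 m_max m4 (leqW q4)).
by rewrite len_refl //; apply: submod_set0.
Qed.

Lemma hilb_3_gt0 : mp 3 <> [set 0] -> (0 < hilb 3)%N.
Proof.
move=> m3; rewrite lt0n; apply/eqP => h0; apply: m3.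
rewrite -m4; apply/seteqP; split; last exact: pow_S.
by apply: (len_eq0 fR (submod_pow m_max 3%N) (submod_pow m_max 4%N) (pow_S m_max (n:=3%N)) h0).
Qed.

Section Resolution.
Context {M : lmodType R} (F : free_resolution M) (n : nat).
Hypotheses (F_min : minimal F m) (F_lin : gr_acyclic_from F m n).
Local Notation b := (rk F).

Lemma sigma_1 j : (n <= j.+1)%N ->
  (sigma m F 1 j + b j.+2 = hilb 1 * b j.+1)%N.
Proof.
move=> nj; rewrite mulnC -(sigma_rec m_max F_min fR F_lin 0 nj).
by rewrite (sigma_0 m_max F_min fR).
Qed.

Lemma sigma_2 j : (n <= j.+1)%N ->
  (sigma m F 2 j + hilb 1 * b j.+2 = hilb 2 * b j.+1 + b j.+3)%N.
Proof.
move=> nj; rewrite -(sigma_1 (leqW nj)) [(hilb 2 * _)%N]mulnC.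
by rewrite -(sigma_rec m_max F_min fR F_lin 1 nj) addnA.
Qed.

Lemma sigma_2S j : (n <= j.+1)%N -> (sigma m F 2 j.+1 = hilb 3 * b j.+1)%N.
Proof.
move=> nj; rewrite mulnC -(sigma_rec m_max F_min fR F_lin 2 nj).
by rewrite (sigma_3 m_max F_min fR m4).
Qed.

(** The length of m^2 S_(j+1) is computed twice: from the ranks above it by [sigma_2], and from
    [sigma_2S], where m^3 S_j = 0 leaves a single term. *)
Lemma betti_rec j : (n <= j.+1)%N ->
  (b (j.+1 + 3) + hilb 2 * b (j.+1 + 1)
   = hilb 1 * b (j.+1 + 2) + hilb 3 * b j.+1)%N.
Proof.
move=> nj; rewrite -(sigma_2S nj) addnC !addn1 !addn2 !addn3.
by rewrite -(sigma_2 (leqW nj)) addnC.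
Qed.

Lemma len_syz j : len [set 0%R] (syz m F 0 j) =
  (b j.+1 + sigma m F 1 j + sigma m F 2 j)%N.
Proof.
have fV : finite_length 'rV[R]_(b j) by apply: finite_length_mx.
rewrite -(syz_eq0 m_max F_min (q := 3%N) j m4) //.
rewrite -(sigma_0 m_max F_min fR).
have hs q := submod_syz m_max F q j.
have hS p q (pq : (p <= q)%N) := @syz_le _ _ m_max _ F p q j pq.
rewrite (len_add fV (hs 3%N) (hs 1%N) (hs 0%N)); try exact: hS.
rewrite (len_add fV (hs 3%N) (hs 2%N) (hs 1%N)); try exact: hS.
rewrite -[LHS]/((sigma m F 2 j + sigma m F 1 j + sigma m F 0 j)%N); lia.
Qed.

End Resolution.
End HilbertCoefficients.

Lemma coef_hilbert_poly (e q : nat) :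
  (1 + e *: 'X + e *: 'X^2 + 'X^3 : {poly nat})`_q =
  nth 0%N [:: 1%N; e; e; 1%N] q.
Proof.
rewrite !coefD !coefZ coef1 coefX !coefXn.
case: q => [|[|[|[|q]]]] /=; rewrite ?(mulr0, mulr1, addr0, add0r) //.
by rewrite nth_nil.
Qed.

Theorem theorem4p3p1 (K : realType) (R : comNzRingType) (m : set R)
    (M N : lmodType R) (bM bN : nat -> nat)
    (R_noetherian : noetherian R) (R_local : local_ring m)
    (m4 : ideal_pow m 4 = [set 0]) (m3 : ideal_pow m 3 <> [set 0])
    (M_fg : finitely_generated M) (N_fg : finitely_generated N)
    (M_linear : eventually_linear m M) (N_linear : eventually_linear m N)
    (N_Ext : exists i0 : nat, forall i : nat, (i0 <= i)%N -> Ext_zero N i)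
    (M_betti : is_betti_sequence m M bM) (N_betti : is_betti_sequence m N bN)
    (M_growth : polynomial_growth K bM)
    (N_growth : exponential_growth K bN) :
  exists e : nat,
    @has_kdim R m R^o m (ideal_pow m 2) e /\
    is_hilbert_poly m (1 + e *: 'X + e *: 'X^2 + 'X^3).
Proof.
have m_max := R_local.1.
have fR := finite_length_ring m_max m4 R_noetherian.
have [FM [FM_min [nM [_ [FM_lin _]]]]] := M_linear.
have [FN [FN_min [nN [_ [FN_lin _]]]]] := N_linear.
have [i0 extN] := N_Ext.
have bME i : bM i.+1 = rk FM i.+1 := betti_rank m_max fR i FM_min M_betti.
have bNE i : bN i.+1 = rk FN i.+1 := betti_rank m_max fR i FN_min N_betti.
have [M_pos M_ratio] := polynomial_growth_ratio M_growth.
have [x [x1 N_pos N_ratio N_inv]] := exponential_growth_ratio N_growth.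
have s_gt0 := hilb_3_gt0 m_max fR m4 m3.
set e := hilb m 1; set r := hilb m 2; set s := hilb m 3.
have hM : (1 : K) + r%:R = e%:R + s%:R.
  have := @char_root K bM 1 e r s M_pos M_ratio; rewrite !expr1n !mulr1; apply.
  exists nM.+1 => // -[|i] //= Mi; rewrite !addSn !bME -!addSn.
  by apply: (betti_rec m_max fR m4 FM_min FM_lin); lia.
have hN : x ^+ 3 + r%:R * x = e%:R * x ^+ 2 + s%:R.
  apply: (@char_root K bN x e r s N_pos N_ratio).
  exists nN.+1 => // -[|i] //= Ni; rewrite !addSn !bNE -!addSn.
  by apply: (betti_rec m_max fR m4 FN_min FN_lin); lia.
(* From [c] on, both resolutions are linear and Ext(N, R) vanishes. The successor keeps indices
   positive, as [betti_rank] covers positive degrees. *)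
pose c := (nM + nN + i0).+1.
have ext i p (Y : 'M[R]_(rk FN i.+2, p)) : (i0 <= i)%N -> dmx FN i.+2 *m Y = 0 ->
    exists Y', Y = dmx FN i.+1 *m Y'.
  by move=> ii0; apply: Ext_zero_mx; apply: extN; lia.
have defect i : (c <= i)%N -> (hom_defect m FM FN i i <= hom_defect m FM FN c c)%N.
  move=> /subnK <-; elim: (i - c)%N => [|t IH] //; rewrite addSn.
  apply: leq_trans IH; apply: (hom_defect_S m_max fR) => p Y.
  by apply: ext; rewrite /c; lia.
have ineq : e%:R * x * (r%:R - e%:R + 1) + x - 1 <= e%:R * e%:R :> K.
  apply: (@limit_inequality K bM bN x e r (hom_defect m FM FN c c)
    (fun i => sigma m FM 1 i) (fun i => sigma m FM 2 i)) => //.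
  - exists c => // i /= ci; rewrite addn1 addn2 !bME.
    by apply: (sigma_1 m_max fR FM_min FM_lin); rewrite /c in ci; lia.
  - exists c => // i /= ci; rewrite addn1 addn2 addn3 !bME.
    by apply: (sigma_2 m_max fR FM_min FM_lin); rewrite /c in ci; lia.
  exists c => // i /= ci; rewrite addn1 bME.
  have -> : bN i = rk FN i by case: i ci => // i _; apply: bNE.
  rewrite bNE -(len_syz m_max fR m4 FM_min).
  have eE : e = len (ideal_pow m 2 : set R^o) m by rewrite /e /hilb pow_1.
  have ni : (nN <= i.+1)%N by rewrite /c in ci; lia.
  apply: leq_trans (main_inequality m_max fR m4 FM_min FN_min FN_lin i eE ni) _.
  by rewrite leq_add2r leq_mul2l leq_add2l (defect i ci) orbT.
have [s1 re] : s = 1%N /\ r = e.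
  apply: (hilbert_coef_eq1 s_gt0 x1 hM hN).
  have <- : r%:R - e%:R + 1 = s%:R :> K by lra.
  exact: ineq.
exists e; split.
  by have := hilb_kdim m_max fR 1; rewrite [X in has_kdim m X](pow_1 m_max).
move=> q; rewrite coef_hilbert_poly.
have -> : nth 0%N [:: 1%N; e; e; 1%N] q = hilb m q.
  case: q => [|[|[|[|q]]]] /=.
  - by rewrite (hilb_0 m_max fR).
  - by [].
  - by rewrite -[RHS]/r re.
  - by rewrite -[RHS]/s s1.
  - by rewrite nth_nil (hilb_ge4 m_max fR m4).
exact: hilb_kdim.
Qed.
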